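(* Let $V\subseteq\mathbb R^n$ be a rational linear subspace, let $D=\{\boldsymbol d\in V:|\boldsymbol u_i^{\mathsf T}\boldsymbol d|\le\rho_i,\ 1\le i\le t\}$ be bounded, with rational vectors $\boldsymbol u_i$ and positive rationals $\rho_i$, let $Q=Q^{\mathsf T}\in\mathbb Q^{n\times n}$, $q(\boldsymbol d)=\boldsymbol d^{\mathsf T}Q\boldsymbol d$, and let $\varphi_{\rm neg}$ be the total encoding length of $V,(\boldsymbol u_i,\rho_i)_i,Q$ and the dimension. The lattice-refinement algorithm described in the context is correct, that is, it returns either a vector $\boldsymbol d\in D\cap\mathbb Z^n$ with $q(\boldsymbol d)<0$, or the answer NONNEGATIVE, and the latter only if $q(\boldsymbol d)\ge0$ for every $\boldsymbol d\in D\cap\mathbb Z^n$. It uses at most $s_{\max}4^n$ optimizer calls and runs in time $$2^{O(n\log(n+1))}(1+\varphi_{\rm neg})^{O(1)}.$$ This bound holds for any number $t$ of two-sided inequalities in the explicit input.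
   Context: Encoding lengths are total binary lengths of rational data; algorithms use exact rational arithmetic, time counts bit operations, and hidden constants (including exponents $O(1)$) are absolute. Optimizer $\mathrm{ConvicMin}(K,h)$. Input: a bounded rational polyhedron $K\subseteq\mathbb R^n$ and a rational quadratic $h(\boldsymbol x)=\boldsymbol x^{\mathsf T}Q_h\boldsymbol x+\boldsymbol c_h^{\mathsf T}\boldsymbol x+\gamma_h$, $Q_h=Q_h^{\mathsf T}$, under the hypothesis $(\boldsymbol y-\boldsymbol x)^{\mathsf T}Q_h(\boldsymbol y-\boldsymbol x)\ge0$ for all $\boldsymbol x,\boldsymbol y\in K\cap\mathbb Z^n$. Output: an exact minimizer of $h$ on $K\cap\mathbb Z^n$, or INFEASIBLE if $K\cap\mathbb Z^n=\varnothing$. It is implemented by a procedure which, given also an integer $R'\ge2$ with $K\cap\mathbb Z^n\subseteq[-R',R']^n$, runs in time $2^{O(n\log(n+1))}(1+\varphi_{\rm cell})^{O(1)}$, where $\varphi_{\rm cell}$ contains the encodings of $K,h,R'$. Notation: $\Gamma_s=V\cap2^s\mathbb Z^n$ for integers $s\ge0$. For $\boldsymbol\delta\in\{0,1,2,3\}^n$, $K_{s,\boldsymbol\delta}=\{\boldsymbol z\in\mathbb R^n:2^s(\boldsymbol\delta+4\boldsymbol z)\in D\}$ and $h_{\boldsymbol\delta}(\boldsymbol z)=q(\boldsymbol\delta+4\boldsymbol z)=16\boldsymbol z^{\mathsf T}Q\boldsymbol z+8(Q\boldsymbol\delta)^{\mathsf T}\boldsymbol z+q(\boldsymbol\delta)$.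 Algorithm. If $n=0$, return NONNEGATIVE. Otherwise compute in polynomial time an integer $R\ge1$ with $D\subseteq[-R,R]^n$ and a level $s_{\max}$ with $2^{s_{\max}}>R$, where $\log(R+1)$ and $s_{\max}$ are polynomially bounded in $\varphi_{\rm neg}$ (so $D\cap\Gamma_{s_{\max}}=\{\boldsymbol0\}$). For $s=s_{\max}-1,s_{\max}-2,\ldots,0$ and for each $\boldsymbol\delta\in\{0,1,2,3\}^n$: form $K_{s,\boldsymbol\delta},h_{\boldsymbol\delta}$ and let $\boldsymbol z\leftarrow\mathrm{ConvicMin}(K_{s,\boldsymbol\delta},h_{\boldsymbol\delta})$; if $\boldsymbol z\ne$ INFEASIBLE and $h_{\boldsymbol\delta}(\boldsymbol z)<0$, return the negative witness $\boldsymbol d=2^s(\boldsymbol\delta+4\boldsymbol z)$ and stop. If all levels are completed, return NONNEGATIVE. *)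

(* Defs.v *)
From HB Require Import structures.
From mathcomp Require Import all_boot all_order all_algebra.
From mathcomp Require Import classical_sets reals.
From mathcomp Require Import ring.

Set Implicit Arguments.
Unset Strict Implicit.
Unset Printing Implicit Defensive.
Import Order.TTheory GRing.Theory Num.Theory.
Local Open Scope ring_scope.
Local Open Scope classical_set_scope.

(* [up_log 2 k.+1] is ceil (log2 (k + 1)); every size is at least 1.        *)
Definition size_nat (k : nat) : nat := (up_log 2 k.+1).+1.

Definition size_rat (a : rat) : nat :=
  (size_nat `|numq a| + size_nat `|denq a|)%N.

Definition size_mx (m n : nat) (A : 'M[rat]_(m, n)) : nat :=
  (\sum_i \sum_j size_rat (A i j))%N.

(* The list [ineqs] of pairs (a, b) stands for {x | a x <= b for all (a, b)};
   an equation is given as two opposite inequalities.  [obj_Q], [obj_c],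
   [obj_g] are the data of h, and [radius] is the integer R' handed to the
   procedure together with K and h.                                         *)
Record query (n : nat) := Query {
  ineqs : seq ('rV[rat]_n * rat);
  obj_Q : 'M[rat]_n;
  obj_c : 'cV[rat]_n;
  obj_g : rat;
  radius : int }.

Definition size_query (n : nat) (k : query n) : nat :=
  (size_nat n
   + \sum_(ab <- ineqs k) (size_mx ab.1 + size_rat ab.2)
   + size_mx (obj_Q k) + size_mx (obj_c k) + size_rat (obj_g k)
   + size_nat `|radius k|)%N.

Definition real_vec (F : realType) (n : nat) (z : 'cV[int]_n) : 'cV[F]_n :=
  map_mx intr z.

Definition quad (F : realType) (n : nat) (Q : 'M[rat]_n) (x : 'cV[F]_n) : F :=
  (x^T *m map_mx ratr Q *m x) 0 0.

Definition in_box (F : realType) (n : nat) (r : int) (x : 'cV[F]_n) : Prop :=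
  forall i, `|x i 0| <= r%:~R.

Definition bounded_region (F : realType) (n : nat) (S : set 'cV[F]_n) : Prop :=
  exists M : F, forall x, S x -> forall i, `|x i 0| <= M.

Definition polyhedron (F : realType) (n : nat) (k : query n) : set 'cV[F]_n :=
  [set x | forall ab, ab \in ineqs k ->
             (map_mx ratr ab.1 *m x) 0 0 <= ratr ab.2].
Arguments polyhedron F {n} k _.

Definition objective (F : realType) (n : nat) (k : query n) (x : 'cV[F]_n) : F :=
  quad (obj_Q k) x + ((map_mx ratr (obj_c k))^T *m x) 0 0 + ratr (obj_g k).

Definition admissible (F : realType) (n : nat) (k : query n) : Prop :=
  [/\ bounded_region (polyhedron F k),
      (obj_Q k)^T = obj_Q k,
      forall x y : 'cV[int]_n,
        polyhedron F k (real_vec F x) -> polyhedron F k (real_vec F y) ->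
        0 <= quad (obj_Q k) (real_vec F y - real_vec F x),
      2 <= radius k &
      forall x : 'cV[int]_n,
        polyhedron F k (real_vec F x) -> in_box (radius k) (real_vec F x)].

(* [None] is the answer INFEASIBLE.  A procedure is seen through its answers
   and its running times only, without restriction on how it works.         *)
Record optimizer := Optimizer {
  answer : forall n, query n -> option 'cV[int]_n;
  cost : forall n, query n -> nat }.

(* 2^(c n log2 (n + 1)) * (1 + phi)^c, as 2^(n log2 (n + 1)) = (n + 1)^n.   *)
Definition time_bound (c n phi : nat) : nat :=
  (n.+1 ^ (c * n) * (1 + phi) ^ c)%N.

Definition exact_answer (F : realType) (n : nat) (k : query n)
    (o : option 'cV[int]_n) : Prop :=
  match o with
  | Some z => polyhedron F k (real_vec F z) /\
      forall y : 'cV[int]_n, polyhedron F k (real_vec F y) ->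
        objective k (real_vec F z) <= objective k (real_vec F y)
  | None => forall y : 'cV[int]_n, ~ polyhedron F k (real_vec F y)
  end.

Definition convicmin_spec (F : realType) (c : nat) (opt : optimizer) : Prop :=
  forall (n : nat) (k : query n), admissible F k ->
    exact_answer F k (answer opt k) /\
    (cost opt k <= time_bound c n (size_query k))%N.

Inductive binop := OpAdd | OpSub | OpMul.

(* Numbers are handled by [Arith] and [Less] only; the continuations do the
   control, and assemble or take apart data.  [Tick c] spends c bit operations
   on control or on reading the input.                                      *)
Inductive prog (A : Type) : Type :=
| Ret of A
| Tick of nat & prog A
| Arith of binop & rat & rat & (rat -> prog A)
| Less of rat & rat & (bool -> prog A)
| Call (n : nat) of query n & (option 'cV[int]_n -> prog A).

Fixpoint bind (A B : Type) (p : prog A) (f : A -> prog B) : prog B :=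
  match p with
  | Ret a => f a
  | Tick c p' => Tick c (bind p' f)
  | Arith o a b g => Arith o a b (fun r => bind (g r) f)
  | Less a b g => Less a b (fun r => bind (g r) f)
  | Call n k g => Call k (fun r => bind (g r) f)
  end.

Notation "'let!' x := p 'in' q" := (bind p (fun x => q))
  (at level 200, x binder, p at level 200, q at level 200).

Definition eval_binop (o : binop) (a b : rat) : rat :=
  match o with OpAdd => a + b | OpSub => a - b | OpMul => a * b end.

Fixpoint result (opt : optimizer) (A : Type) (p : prog A) : A :=
  match p with
  | Ret a => a
  | Tick _ p' => result opt p'
  | Arith o a b g => result opt (g (eval_binop o a b))
  | Less a b g => result opt (g (a < b))
  | Call n k g => result opt (g (answer opt k))
  end.

(* Schoolbook bit cost of an exact operation on normalized fractions,
   including the reduction of the result by Euclid's algorithm.             *)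
Definition op_cost (a b : rat) : nat := ((1 + size_rat a + size_rat b) ^ 2)%N.

(* A call costs the running time of the optimizer on the query, and the time
   to write the query down.                                                 *)
Fixpoint run_time (opt : optimizer) (A : Type) (p : prog A) : nat :=
  match p with
  | Ret _ => 0
  | Tick c p' => c + run_time opt p'
  | Arith o a b g => op_cost a b + run_time opt (g (eval_binop o a b))
  | Less a b g => op_cost a b + run_time opt (g (a < b)%R)
  | Call n k g => size_query k + cost opt k + run_time opt (g (answer opt k))
  end%N.

Fixpoint calls (opt : optimizer) (A : Type) (p : prog A) : nat :=
  match p with
  | Ret _ => 0
  | Tick _ p' => calls opt p'
  | Arith o a b g => calls opt (g (eval_binop o a b))
  | Less a b g => calls opt (g (a < b)%R)
  | Call n k g => (calls opt (g (answer opt k))).+1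
  end%N.

Definition addM (a b : rat) : prog rat := Arith OpAdd a b (@Ret rat).
Definition subM (a b : rat) : prog rat := Arith OpSub a b (@Ret rat).
Definition mulM (a b : rat) : prog rat := Arith OpMul a b (@Ret rat).
Definition lessM (a b : rat) : prog bool := Less a b (@Ret bool).

Fixpoint mapM (I B : Type) (f : I -> prog B) (l : seq I) : prog (seq B) :=
  if l is i :: l' then
    Tick 1 (let! b := f i in let! bs := mapM f l' in Ret (b :: bs))
  else Ret [::].

Definition rowM (n : nat) (f : 'I_n -> prog rat) : prog 'rV[rat]_n :=
  let! s := mapM f (enum 'I_n) in Ret (\row_j s`_j).

Definition colM (n : nat) (f : 'I_n -> prog rat) : prog 'cV[rat]_n :=
  let! s := mapM f (enum 'I_n) in Ret (\col_i s`_i).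

Definition mxM (n : nat) (f : 'I_n -> 'I_n -> prog rat) : prog 'M[rat]_n :=
  let! s := mapM (fun i => mapM (f i) (enum 'I_n)) (enum 'I_n) in
  Ret (\matrix_(i, j) (nth [::] s i)`_j).

Fixpoint sum_mulM (I : Type) (a b : I -> rat) (l : seq I) : prog rat :=
  if l is i :: l' then
    Tick 1 (let! s := sum_mulM a b l' in let! t := mulM (a i) (b i) in addM t s)
  else Ret 0.

Definition dotM (n : nat) (a b : 'I_n -> rat) : prog rat :=
  sum_mulM a b (enum 'I_n).

Fixpoint pow2M (k : nat) : prog rat :=
  if k is k'.+1 then Tick 1 (let! w := pow2M k' in addM w w) else Ret 1.

(* V is given by equations: V = {x | eqs x = 0}.                            *)
Record instance (n : nat) := Instance {
  neqs : nat;
  eqs : 'M[rat]_(neqs, n);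
  nslabs : nat;
  slabs : 'M[rat]_(nslabs, n);
  widths : 'cV[rat]_nslabs;
  formQ : 'M[rat]_n }.

Definition size_instance (n : nat) (I : instance n) : nat :=
  (size_nat n + size_mx (eqs I) + size_mx (slabs I) + size_mx (widths I)
   + size_mx (formQ I))%N.

Definition subspaceV (F : realType) (n : nat) (I : instance n) : set 'cV[F]_n :=
  [set x | map_mx ratr (eqs I) *m x = 0].
Arguments subspaceV F {n} I _.

Definition regionD (F : realType) (n : nat) (I : instance n) : set 'cV[F]_n :=
  [set x | subspaceV F I x /\
     forall i, `|(map_mx ratr (slabs I) *m x) i 0| <= ratr (widths I i 0)].
Arguments regionD F {n} I _.

Definition well_formed (F : realType) (n : nat) (I : instance n) : Prop :=
  [/\ forall i, 0 < widths I i 0,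
      (formQ I)^T = formQ I &
      bounded_region (regionD F I)].

(* From a x <= b with x = w (delta + 4 z) to (4 w a) z <= b - w (a delta).  *)
Definition pull_ineq (n : nat) (w w4 : rat) (delta : 'cV[rat]_n)
    (a : 'rV[rat]_n) (b : rat) : prog ('rV[rat]_n * rat) :=
  let! a' := rowM (fun j => mulM w4 (a 0 j)) in
  let! e := dotM (a 0) (delta^~ 0) in
  let! e' := mulM w e in
  let! b' := subM b e' in
  Ret (a', b').

Definition pull_slab (n : nat) (w w4 : rat) (delta : 'cV[rat]_n)
    (a : 'rV[rat]_n) (b : rat) : prog (seq ('rV[rat]_n * rat)) :=
  let! c1 := pull_ineq w w4 delta a b in
  let! na := rowM (fun j => subM 0 (a 0 j)) in
  let! c2 := pull_ineq w w4 delta na b in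
  Ret [:: c1; c2].

Definition cell_query (n : nat) (I : instance n) (w : rat) (r : int)
    (delta : 'cV[rat]_n) : prog (query n) :=
  let! w4 := mulM 4 w in
  let! Ke := mapM (fun i => pull_slab w w4 delta (row i (eqs I)) 0)
                  (enum 'I_(neqs I)) in
  let! Ks := mapM (fun i => pull_slab w w4 delta (row i (slabs I))
                                      (widths I i 0))
                  (enum 'I_(nslabs I)) in
  let! Qh := mxM (fun i j => mulM 16 (formQ I i j)) in
  let! Qdelta := colM (fun i => dotM (formQ I i) (delta^~ 0)) in
  let! ch := colM (fun i => mulM 8 (Qdelta i 0)) in
  let! gh := dotM (delta^~ 0) (Qdelta^~ 0) in
  Ret (Query (flatten Ke ++ flatten Ks) Qh ch gh r).

Lemma result_bind opt A B (p : prog A) (f : A -> prog B) :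
  result opt (bind p f) = result opt (f (result opt p)).
Proof. by elim: p => //=. Qed.

Lemma result_mapM opt (I B : Type) (f : I -> prog B) l :
  result opt (mapM f l) = [seq result opt (f i) | i <- l].
Proof. by elim: l => //= i l IH; rewrite !result_bind /= IH. Qed.

Lemma result_rowM opt n (f : 'I_n -> prog rat) :
  result opt (rowM f) = \row_j result opt (f j).
Proof.
rewrite result_bind result_mapM /=; apply/rowP => j; rewrite !mxE.
by rewrite (nth_map j) ?size_enum_ord // nth_ord_enum.
Qed.

Lemma result_colM opt n (f : 'I_n -> prog rat) :
  result opt (colM f) = \col_j result opt (f j).
Proof.
rewrite result_bind result_mapM /=; apply/colP => j; rewrite !mxE.
by rewrite (nth_map j) ?size_enum_ord // nth_ord_enum.
Qed.

Lemma result_mxM opt n (f : 'I_n -> 'I_n -> prog rat) :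
  result opt (mxM f) = \matrix_(i, j) result opt (f i j).
Proof.
rewrite result_bind result_mapM /=; apply/matrixP => i j; rewrite !mxE.
rewrite (nth_map i) ?size_enum_ord // result_mapM.
by rewrite (nth_map j) ?size_enum_ord // !nth_ord_enum.
Qed.

Lemma result_dotM opt n (a b : 'I_n -> rat) :
  result opt (dotM a b) = \sum_i a i * b i.
Proof.
rewrite -big_enum /dotM; elim: (enum _) => /= [|i l IH]; first by rewrite big_nil.
by rewrite !result_bind /= IH big_cons addrC.
Qed.

Lemma result_pow2M opt k : result opt (pow2M k) = 2 ^+ k.
Proof.
by elim: k => //= k IH; rewrite result_bind /= IH exprS mulr_natl mulr2n.
Qed.

Definition pulled n w (delta : 'cV[rat]_n) (a : 'rV[rat]_n) b :=
  ((4 * w) *: a, b - w * (a *m delta) 0 0).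

Lemma result_pull_ineq opt n w (delta : 'cV[rat]_n) a b :
  result opt (pull_ineq w (4 * w) delta a b) = pulled w delta a b.
Proof.
rewrite /pull_ineq (result_bind _ (rowM _)) result_rowM.
rewrite (result_bind _ (dotM _ _)) result_dotM /=.
by congr (_, _); [apply/rowP => j; rewrite !mxE | rewrite mxE].
Qed.

Lemma result_pull_slab opt n w (delta : 'cV[rat]_n) a b :
  result opt (pull_slab w (4 * w) delta a b)
  = [:: pulled w delta a b; pulled w delta (- a) b].
Proof.
rewrite /pull_slab.
rewrite (result_bind _ (pull_ineq _ _ _ _ _)) result_pull_ineq.
rewrite (result_bind _ (rowM _)) result_rowM.
rewrite (result_bind _ (pull_ineq _ _ _ _ _)) result_pull_ineq /=.
congr [:: _; pulled _ _ _ _]; apply/rowP => j; rewrite !mxE /=; exact: sub0r.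
Qed.

Definition cell_data n (I : instance n) w r (delta : 'cV[rat]_n) :=
  Query (flatten [seq [:: pulled w delta (row i (eqs I)) 0; pulled w delta (- row i (eqs I)) 0] | i <- enum 'I_(neqs I)] ++
   flatten [seq [:: pulled w delta (row i (slabs I)) (widths I i 0); pulled w delta (- row i (slabs I)) (widths I i 0)] | i <- enum 'I_(nslabs I)])
  (16 *: formQ I) (8 *: (formQ I *m delta)) ((delta^T *m formQ I *m delta) 0 0) r.

Lemma result_cell_query opt n (I : instance n) w r delta :
  result opt (cell_query I w r delta) = cell_data I w r delta.
Proof.
rewrite /cell_query (result_bind _ (mulM _ _)) /=.
rewrite !(result_bind _ (mapM _ _)) !result_mapM.
rewrite (result_bind _ (mxM _)) result_mxM.
rewrite !(result_bind _ (colM _)) !result_colM.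
rewrite (result_bind _ (dotM _ _)) result_dotM /cell_data /=.
congr Query.
- by congr (flatten _ ++ flatten _); apply: eq_map => i; rewrite result_pull_slab.
- by apply/matrixP => i j; rewrite !mxE.
- by apply/colP => i; rewrite !mxE /= result_dotM.
- rewrite -mulmxA mxE; apply: eq_bigr => i _; rewrite !mxE; congr (_ * _).
  by rewrite result_dotM.
Qed.

Definition cell_point (F : realType) (n : nat) (delta : 'cV[rat]_n)
    (z : 'cV[F]_n) : 'cV[F]_n :=
  map_mx ratr delta + 4 *: z.

Lemma pulledP (F : realType) (n : nat) (w : rat) (delta : 'cV[rat]_n)
    (a : 'rV[rat]_n) b (z : 'cV[F]_n) :
  ((map_mx ratr (pulled w delta a b).1 *m z) 0 0 <= ratr (pulled w delta a b).2) =
  ((map_mx ratr a *m (ratr w *: cell_point delta z)) 0 0 <= ratr b).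
Proof.
rewrite /pulled /= map_mxZ rmorphB !rmorphM /= /cell_point.
have -> : ratr ((a *m delta) 0 0) = (map_mx ratr a *m map_mx ratr delta) 0 0 :> F.
  by rewrite -map_mxM [RHS]mxE.
rewrite -scalerA -!scalemxAl -!scalemxAr mulmxDr -!scalemxAr rmorph_nat.
have E (c : F) (M : 'M[F]_1) : (c *: M) 0 0 = c * M 0 0 by rewrite mxE.
have E2 (M N : 'M[F]_1) : (M + N) 0 0 = M 0 0 + N 0 0 by rewrite mxE.
rewrite !E E2 E.
set X := (_ *m z) _ _; set Y := (_ *m _) _ _.
by rewrite lerBrDr; congr (_ <= _); ring.
Qed.

Lemma cell_dataP (F : realType) (n : nat) (I : instance n) (w : rat) (r : int)
    (delta : 'cV[rat]_n) (z : 'cV[F]_n) :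
  polyhedron F (cell_data I w r delta) z <-> regionD F I (ratr w *: cell_point delta z).
Proof.
have rowE m (M : 'M[rat]_(m, n)) i y :
   (map_mx ratr (row i M) *m y) 0 0 = (map_mx ratr M *m y) i 0 :> F.
  by rewrite map_row -row_mul mxE.
have rowNE m (M : 'M[rat]_(m, n)) i y :
   (map_mx ratr (- row i M) *m y) 0 0 = - (map_mx ratr M *m y) i 0 :> F.
  by rewrite map_mxN mulNmx mxE rowE.
split=> [H | [H1 H2] ab].
  split.
    apply/colP => i; rewrite [RHS]mxE; apply/eqP; rewrite eq_le.
    have K1 : pulled w delta (row i (eqs I)) 0 \in ineqs (cell_data I w r delta).
      rewrite mem_cat; apply/orP; left; apply/flatten_mapP; exists i; rewrite ?mem_enum //.
      by rewrite inE eqxx.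
    have K2 : pulled w delta (- row i (eqs I)) 0 \in ineqs (cell_data I w r delta).
      rewrite mem_cat; apply/orP; left; apply/flatten_mapP; exists i; rewrite ?mem_enum //.
      by rewrite !inE eqxx orbT.
    move: (H _ K1) (H _ K2); rewrite !pulledP rowE rowNE raddf0 oppr_le0 => -> ->.
    by [].
  move=> i; rewrite ler_norml.
  have K1 : pulled w delta (row i (slabs I)) (widths I i 0) \in ineqs (cell_data I w r delta).
    rewrite mem_cat; apply/orP; right; apply/flatten_mapP; exists i; rewrite ?mem_enum //.
    by rewrite inE eqxx.
  have K2 : pulled w delta (- row i (slabs I)) (widths I i 0) \in ineqs (cell_data I w r delta).
    rewrite mem_cat; apply/orP; right; apply/flatten_mapP; exists i; rewrite ?mem_enum //.
    by rewrite !inE eqxx orbT.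
  move: (H _ K1) (H _ K2); rewrite !pulledP rowE rowNE => -> /= h.
  by rewrite lerNl h.
rewrite mem_cat => /orP[] /flatten_mapP[i _]; rewrite !inE => /orP[] /eqP->;
  rewrite pulledP ?rowE ?rowNE.
- by rewrite H1 mxE raddf0.
- by rewrite H1 mxE rmorph0 ?oppr0 ?lexx.
- by move: (H2 i); rewrite ler_norml => /andP[].
- by move: (H2 i); rewrite ler_norml lerNl => /andP[].
Qed.

Lemma cell_data_objective (F : realType) (n : nat) (I : instance n) (w : rat) (r : int)
    (delta : 'cV[rat]_n) (z : 'cV[F]_n) : (formQ I)^T = formQ I ->
  objective (cell_data I w r delta) z = quad (formQ I) (cell_point delta z).
Proof.
move=> sQ; rewrite /objective /quad /cell_data /= /cell_point.
rewrite !map_mxZ !map_mxM.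
set Q := map_mx ratr (formQ I); set D := map_mx ratr delta : 'cV[F]_n.
have sQ' : Q^T = Q by rewrite /Q map_trmx sQ.
have -> : ratr ((delta^T *m formQ I *m delta) 0 0) = (D^T *m Q *m D) 0 0 :> F.
  by rewrite /D /Q map_trmx -!map_mxM [RHS]mxE.
have E : (z^T *m Q *m D) = D^T *m Q *m z.
  rewrite [LHS](_ : _ = (z^T *m Q *m D)^T); last by apply/matrixP => i j; rewrite !ord1 [RHS]mxE.
  by rewrite !trmx_mul trmxK sQ' mulmxA.
have E1 (c : F) (M : 'M[F]_1) : (c *: M) 0 0 = c * M 0 0 by rewrite mxE.
have E2 (M N : 'M[F]_1) : (M + N) 0 0 = M 0 0 + N 0 0 by rewrite mxE.
rewrite [(_ + _)^T]linearD /= !(linearZ, mulmxDl, mulmxDr) /= -!(scalemxAl, scalemxAr) ?trmx_mul ?sQ' E.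
rewrite !(E1, E2) !rmorph_nat.
ring.
Qed.

(* For w = 2^s, the query built by the program is (K_{s,delta}, h_delta).   *)
Lemma cell_query_polyhedron (F : realType) (opt : optimizer) (n : nat)
    (I : instance n) (w : rat) (r : int) (delta : 'cV[rat]_n) (z : 'cV[F]_n) :
  polyhedron F (result opt (cell_query I w r delta)) z <->
  regionD F I (ratr w *: cell_point delta z).
Proof. by rewrite result_cell_query; apply: cell_dataP. Qed.

Lemma cell_query_objective (F : realType) (opt : optimizer) (n : nat)
    (I : instance n) (w : rat) (r : int) (delta : 'cV[rat]_n) (z : 'cV[F]_n) :
  (formQ I)^T = formQ I ->
  objective (result opt (cell_query I w r delta)) z =
  quad (formQ I) (cell_point delta z).
Proof. by rewrite result_cell_query; apply: cell_data_objective. Qed.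

Definition eval_objective (n : nat) (k : query n) (z : 'cV[rat]_n) : prog rat :=
  let! Qz := colM (fun i => dotM (obj_Q k i) (z^~ 0)) in
  let! e2 := dotM (z^~ 0) (Qz^~ 0) in
  let! e1 := dotM ((obj_c k)^~ 0) (z^~ 0) in
  let! e := addM e2 e1 in
  addM e (obj_g k).

(* The entries of w (delta + 4 z) are integers for w = 2^s.                 *)
Definition witness (n : nat) (w : rat) (delta z : 'cV[rat]_n) :
    prog 'cV[int]_n :=
  let! d := colM (fun i => let! e := mulM 4 (z i 0) in
                           let! e' := addM (delta i 0) e in
                           mulM w e') in
  Ret (map_mx numq d).

Definition digit (n : nat) := {ffun 'I_n -> 'I_4}.

Definition digit_vec (n : nat) (delta : digit n) : 'cV[rat]_n :=
  \col_i (delta i)%:R.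

(* [None] means that no negative vector has been found.  The ticks pay for
   the advance of the counter delta in base 4.                              *)
Fixpoint search_cells (n : nat) (I : instance n) (w : rat) (r : int)
    (ds : seq (digit n)) : prog (option 'cV[int]_n) :=
  if ds is delta :: ds' then
    Tick n.+1
    (let! k := cell_query I w r (digit_vec delta) in
     Call k (fun o =>
       if o is Some z then
         let! v := eval_objective k (map_mx intr z) in
         let! neg := lessM v 0 in
         if neg then
           let! d := witness w (digit_vec delta) (map_mx intr z) in Ret (Some d)
         else search_cells I w r ds'
       else search_cells I w r ds'))
  else Ret None.

(* Levels s - 1, s - 2, ..., 0.                                             *)
Fixpoint search_levels (n : nat) (I : instance n) (r : int) (s : nat) :
    prog (option 'cV[int]_n) :=
  if s is s'.+1 then
    Tick 1
    (let! w := pow2M s' in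
     let! o := search_cells I w r (enum (digit n)) in
     if o is Some d then Ret (Some d) else search_levels I r s')
  else Ret None.

(* The initial step, which computes (R, s_max).                             *)
Definition bounding := forall n : nat, instance n -> prog (int * nat).

Definition bounding_spec (F : realType) (opt : optimizer) (c : nat)
    (bnd : bounding) : Prop :=
  forall (n : nat) (I : instance n), (0 < n)%N -> well_formed F I ->
    let R := (result opt (bnd n I)).1 in
    let smax := (result opt (bnd n I)).2 in
    let phi1 := ((1 + size_instance I) ^ c)%N in
    [/\ 1 <= R /\ (forall x, regionD F I x -> in_box R x),
        R < 2 ^+ smax,
        (up_log 2 `|(R + 1)%R| <= phi1)%N /\ (smax <= phi1)%N,
        calls opt (bnd n I) = 0%N &
        (run_time opt (bnd n I) <= phi1)%N].

(* R = 2^phi suffices for an instance of encoding length phi, by Cramer's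
   rule.  The tick pays for one pass over the input, which measures phi.    *)
Definition cramer_bounding : bounding := fun n I =>
  let phi := size_instance I in
  Tick phi (let! R := pow2M phi in Ret (numq R, phi.+1)).

(* [None] is the answer NONNEGATIVE.  R + 1 is a valid radius for every
   query, as |delta_i + 4 z_i| <= R implies |z_i| <= (R + 3) / 4 <= R.      *)
Definition refinement (bnd : bounding) (n : nat) (I : instance n) :
    prog (option 'cV[int]_n) :=
  if n == 0%N then Tick 1 (Ret None) else
  let! Rs := bnd n I in
  let! r := addM Rs.1%:~R 1 in
  search_levels I (numq r) Rs.2.

Definition correct_answer (F : realType) (n : nat) (I : instance n)
    (o : option 'cV[int]_n) : Prop :=
  match o with
  | Some d => regionD F I (real_vec F d) /\ quad (formQ I) (real_vec F d) < 0
  | None => forall d : 'cV[int]_n,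
      regionD F I (real_vec F d) -> 0 <= quad (formQ I) (real_vec F d)
  end.

(* Main.v *)
Require Import Defs.
From mathcomp Require Import all_boot all_order all_algebra.
From mathcomp Require Import classical_sets reals.
From mathcomp Require Import perm ring lra zify.

(* Correctness goes down the levels: if q >= 0 on the points of D lying in
   2^(s+1) Z^n, then two lattice points x, y of a cell K_{s,delta} yield such a
   point 2^(s+1) (y - x), half the difference of two points of the symmetric
   convex set D; so h_delta meets the hypothesis of the optimizer, and its sign
   on the cell is decided exactly.  Each point of 2^s Z^n lies in one of the 4^n
   cells.
   For the running time, all numbers of the computation have O(M^3) bits, where
   M is polynomial in the encoding length phi; the total is then bounded by a
   power of (n+1)^n (1 + phi).
   The initial radius comes from Cramer's rule: since D is bounded, some n of
   the constraints are independent, and the product of their denominators and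
   absolute row sums is at most 2^phi. *)

Set Implicit Arguments.
Unset Strict Implicit.
Unset Printing Implicit Defensive.
Import Order.TTheory GRing.Theory Num.Theory.
Local Open Scope ring_scope.

(** * Bit lengths *)

(* Unlike [size_rat], this measure grows additively under both sum and product,
   so that a sum of n products stays polynomial. *)
Definition fits (m : nat) (a : rat) : bool :=
  (`|numq a| < 2 ^ m)%N && (`|denq a| < 2 ^ m)%N.

Lemma fits_leq m m' a : (m <= m')%N -> fits m a -> fits m' a.
Proof.
move=> le_m /andP[ltn ltd]; have le2 : (2 ^ m <= 2 ^ m')%N by rewrite leq_exp2l.
by rewrite /fits (leq_trans ltn le2) (leq_trans ltd le2).
Qed.

(** Reduction divides numerator and denominator by a common integer factor, so it increases neither
    of them. *)
Lemma fits_frac m (p q : int) : q != 0 ->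
  (`|p| < 2 ^ m)%N -> (`|q| < 2 ^ m)%N -> fits m (p%:Q / q%:Q).
Proof.
move=> q0; case: divqP q0 => [//|k a k0 _].
rewrite !abszM => ltp ltq; have k1 : (0 < `|k|)%N by rewrite absz_gt0.
rewrite /fits (leq_ltn_trans _ ltp) ?leq_pmull //.
by rewrite (leq_ltn_trans _ ltq) ?leq_pmull.
Qed.

Lemma fitsM m m' a b : fits m a -> fits m' b -> fits (m + m') (a * b).
Proof.
move=> /andP[an ad] /andP[bn bd].
have -> : a * b = (numq a * numq b)%:Q / (denq a * denq b)%:Q.
  by rewrite -[a in LHS]divq_num_den -[b in LHS]divq_num_den !rmorphM /= mulf_div.
apply: fits_frac; first by rewrite mulf_neq0.
  by rewrite abszM expnD ltn_mul.
by rewrite abszM expnD ltn_mul.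
Qed.

Lemma fitsD m m' a b : fits m a -> fits m' b -> fits (m + m').+1 (a + b).
Proof.
move=> /andP[an ad] /andP[bn bd].
have -> : a + b = (numq a * denq b + numq b * denq a)%:Q / (denq a * denq b)%:Q.
  rewrite -[a in LHS]divq_num_den -[b in LHS]divq_num_den.
  by rewrite addf_div ?intr_eq0 ?denq_neq0 // !(rmorphM, rmorphD).
apply: fits_frac; first by rewrite mulf_neq0.
  (* Each cross product is below [2 ^ (m + m')]; adding the two costs the one extra bit. *)
  have := ltn_mul an bd; have := ltn_mul ad bn; rewrite expnS expnD.
  move: (2 ^ m)%N (2 ^ m')%N an ad bn bd => x y; nia.
rewrite abszM expnS expnD; have := ltn_mul ad bd; lia.
Qed.

Lemma fitsN m a : fits m (- a) = fits m a.
Proof. by rewrite /fits numqN denqN abszN. Qed.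

Lemma fits_int m (z : int) : (0 < m)%N -> (`|z| < 2 ^ m)%N -> fits m z%:~R.
Proof. by move=> m0 ltz; rewrite /fits numq_int denq_int ltz absz1 -{1}(expn0 2) ltn_exp2l. Qed.

Lemma fits0 : fits 1 0. Proof. by []. Qed.

Lemma fits_size_rat a : fits (size_rat a) a.
Proof.
have lt_size (k m : nat) : (size_nat k <= m)%N -> (k < 2 ^ m)%N.
  move=> le_m; apply: leq_trans (up_logP k.+1 (isT : 1 < 2)%N) _.
  by rewrite leq_exp2l // (leq_trans _ le_m).
by rewrite /fits !lt_size // /size_rat ?leq_addr ?leq_addl.
Qed.

Lemma size_nat_leq m k : (k < 2 ^ m)%N -> (size_nat k <= m.+1)%N.
Proof. by move=> ltk; rewrite ltnS up_log_min. Qed.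

Lemma size_rat_leq m a : fits m a -> (size_rat a <= m.+1.*2)%N.
Proof.
by case/andP=> /size_nat_leq ltn /size_nat_leq ltd; rewrite -addnn leq_add.
Qed.

Lemma op_cost_leq m a b : fits m a -> fits m b -> (op_cost a b <= (5 + 4 * m) ^ 2)%N.
Proof.
move=> /size_rat_leq sa /size_rat_leq sb; rewrite leq_exp2r //.
by move: sa sb; rewrite -!muln2; lia.
Qed.

(** Over the product of the denominators the bits only add up, with one more bit per addition, so
    the length is linear in the number of terms. The outer successor serves the empty sum: 0 has
    denominator 1. *)
Lemma fits_sum (I : Type) (r : seq I) m (F : I -> rat) :
  (forall i, fits m (F i)) -> fits (size r * m.+1).+1 (\sum_(i <- r) F i).
Proof.
move=> fitF; elim: r => [|i r IH]; first by rewrite big_nil.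
rewrite big_cons; apply: fits_leq (fitsD (fitF i) IH).
by rewrite /= mulSn; lia.
Qed.

Lemma leq_size_mx m n (A : 'M[rat]_(m, n)) i j : (size_rat (A i j) <= size_mx A)%N.
Proof. by rewrite /size_mx (bigD1 i) //= (bigD1 j) //= -addnA leq_addr. Qed.

(** Every entry has size at least 1 and the rows are nonempty. This bounds the numbers of equations
    and slabs by the encoding length. *)
Lemma rows_leq_size_mx m n (A : 'M[rat]_(m, n)) : (0 < n)%N -> (m <= size_mx A)%N.
Proof.
case: n A => // n A _; rewrite /size_mx -[X in (X <= _)%N]card_ord -sum1_card.
by apply: leq_sum => i _; rewrite big_ord_recl.
Qed.

Lemma size_mx_leq m n t (A : 'M[rat]_(m, n)) :
  (forall i j, fits t (A i j)) -> (size_mx A <= m * (n * t.+1.*2))%N.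
Proof.
move=> fitA; rewrite /size_mx.
apply: (@leq_trans (\sum_(i < m) \sum_(j < n) t.+1.*2)%N).
  by do 2![apply: leq_sum => ? _]; apply: size_rat_leq.
by rewrite !sum_nat_const !card_ord.
Qed.

(** * A radius from Cramer's rule *)

(** Expanding the product gives one term for each map from rows to columns. The permutations among
    these maps give the absolute values of the Leibniz terms, and the other terms are
    nonnegative. *)
Lemma norm_det_leq (R : numDomainType) n (A : 'M[R]_n) :
  `|\det A| <= \prod_i \sum_j `|A i j|.
Proof.
rewrite bigA_distr_bigA /=.
apply: le_trans (ler_norm_sum _ _ _) _.
have -> : \sum_(s : {perm 'I_n}) `|(-1) ^+ s * \prod_i A i (s i)|
        = \sum_(f in [set pval s | s in [set: {perm 'I_n}]]) \prod_i `|A i (f i)|.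
  rewrite big_imset; last by move=> s t _ _ /val_inj.
  rewrite big_mkcond [RHS]big_mkcond; apply: eq_bigr => s _.
  rewrite inE /= normrM normrX normrN1 expr1n mul1r normr_prod.
  by apply: eq_bigr => i _; rewrite pvalE.
rewrite [leRHS](bigID (mem [set pval s | s in [set: {perm 'I_n}]])) /=.
by rewrite lerDl sumr_ge0 // => f _; apply: prodr_ge0.
Qed.

Lemma sum_ltr_prod (R : numDomainType) (I : Type) (r : seq I) (P : pred I) (a : I -> R) :
  (forall i, 0 <= a i) -> 1 + \sum_(i <- r | P i) a i <= \prod_(i <- r | P i) (1 + a i).
Proof.
move=> a0; suff [] : 0 <= \sum_(i <- r | P i) a i /\
  1 + \sum_(i <- r | P i) a i <= \prod_(i <- r | P i) (1 + a i) by [].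
apply: (big_ind2 (fun x y => 0 <= x /\ 1 + x <= y)) => [|x1 x2 y1 y2 [x0 lex] [y0 ley]|i _].
- by rewrite addr0.
- split; first exact: addr_ge0.
  apply: le_trans (ler_pM _ _ lex ley); rewrite ?addr_ge0 //.
  have -> : (1 + x1) * (1 + y1) = 1 + (x1 + y1) + x1 * y1 by ring.
  by rewrite lerDl mulr_ge0.
by [].
Qed.

(** Multiplying each row by the product of its denominators gives an integer matrix, whose nonzero
    determinant is at least 1 in absolute value. *)
Lemma det_denq_ge1 n (A : 'M[rat]_n) : \det A != 0 ->
  1 <= (\prod_i \prod_j (denq (A i j))%:~R) * `|\det A|.
Proof.
move=> detA; pose d := \row_i (\prod_j (denq (A i j))%:~R : rat).
have d_ge0 : 0 <= \prod_i \prod_j (denq (A i j))%:~R :> rat.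
  by do 2![apply: prodr_ge0 => ? _]; rewrite ler0z.
have d_neq0 : \prod_i \prod_j (denq (A i j))%:~R != 0 :> rat.
  by apply/prodf_neq0 => i _; apply/prodf_neq0 => j _; rewrite intr_eq0 denq_neq0.
pose B := \matrix_(i, j) (numq (A i j) * \prod_(k | k != j) denq (A i k)).
have detB : (\prod_i \prod_j (denq (A i j))%:~R) * \det A = (\det B)%:~R.
  have -> : \prod_i \prod_j (denq (A i j))%:~R = \det (diag_mx d).
    by rewrite det_diag; apply: eq_bigr => i _; rewrite mxE.
  rewrite -det_mulmx -det_map_mx; congr (\det _).
  apply/matrixP => i j; rewrite mul_diag_mx !mxE /= rmorphM /= numqE rmorph_prod /=.
  by rewrite (bigD1 j) //= mulrAC [_ * A i j]mulrC.
rewrite -{1}(ger0_norm d_ge0) -normrM detB -intr_norm -[1]/(1%:~R) ler_int.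
rewrite -gtz0_ge1 normr_gt0 -(intr_eq0 rat) -detB.
by rewrite mulf_neq0.
Qed.

Lemma size_natP k : (k < 2 ^ (size_nat k).-1)%N.
Proof. exact: up_logP. Qed.

(** The left-hand side is the denominator plus the absolute numerator. It is the factor that one
    matrix entry contributes to the bound from Cramer's rule. *)
Lemma denq_norm_leq a : (denq a)%:~R * (1 + `|a|) <= 2 ^+ size_rat a :> rat.
Proof.
have den_ge0 : 0 <= (denq a)%:~R :> rat by rewrite ler0z.
have -> : (denq a)%:~R * (1 + `|a|) = (`|denq a| + `|numq a|)%N%:R :> rat.
  rewrite natrD !natr_absz !intr_norm numqE normrM !(ger0_norm den_ge0).
  by rewrite mulrDr mulr1 [_ * `|a|]mulrC.
rewrite -natrX ler_nat.
have := size_natP `|numq a|; have := size_natP `|denq a|.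
rewrite /size_rat /size_nat /= !(addnS, addSn) !expnS expnD.
by move: (2 ^ _)%N (2 ^ _)%N => x y; nia.
Qed.

Lemma norm_leq a : 1 + `|a| <= 2 ^+ size_rat a :> rat.
Proof.
apply: le_trans (denq_norm_leq a); rewrite ler_peMl ?addr_ge0 //.
by rewrite -[1]/(1%:~R) ler_int -gtz0_ge1 denq_gt0.
Qed.

Section Cramer.
Variables (F : realType) (n : nat) (M : 'M[rat]_n) (x : 'cV[F]_n).
Hypothesis detM : \det M != 0.

Let y := map_mx ratr M *m x.

(** Cramer's rule without division: the cofactors along column [j] do not see the replaced
    column. *)
Lemma cramer_entry j :
  x j 0 * \det (map_mx ratr M) =
  \det (\matrix_(i, k) if k == j then y i 0 else ratr (M i k)).
Proof.
rewrite [RHS](expand_det_col _ j).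
have -> : x j 0 * \det (map_mx ratr M) = (\adj (map_mx ratr M) *m y) j 0.
  by rewrite /y mulmxA mul_adj_mx mul_scalar_mx mxE mulrC.
rewrite mxE; apply: eq_bigr => i _; rewrite !mxE eqxx mulrC; congr (_ * _).
rewrite /cofactor; congr (_ * \det _); apply/matrixP => i' k; rewrite !mxE.
by rewrite eq_sym (negPf (neq_lift _ _)).
Qed.

(** Multiplied by all denominators, [\det M] is at least 1 in absolute value, so no division by it
    is needed. The determinant from Cramer's rule is then estimated row by row, each row taking its
    own denominators. *)
Lemma cramer_bound (w b : 'I_n -> nat) j :
  (forall i, `|y i 0| <= 2 ^+ b i - 1) ->
  (forall i, \sum_k size_rat (M i k) <= w i)%N ->
  `|x j 0| <= 2 ^+ (\sum_i (w i + b i))%N.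
Proof.
move=> leyb lew.
pose d i : F := \prod_k (denq (M i k))%:~R.
have d_ge0 i : 0 <= d i by apply: prodr_ge0 => k _; rewrite ler0z.
have den1 : 1 <= (\prod_i d i) * `|\det (map_mx ratr M) : F|.
  have := det_denq_ge1 detM; rewrite -(ler_rat F) rmorph1 rmorphM /= ratr_norm.
  rewrite -det_map_mx rmorph_prod; congr (_ <= _ * _); apply: eq_bigr => i _.
  by rewrite rmorph_prod; apply: eq_bigr => k _; rewrite /= ratr_int.
have xle : `|x j 0| <= (\prod_i d i) * `|x j 0 * \det (map_mx ratr M)|.
  by rewrite normrM mulrCA ler_peMr.
apply: le_trans xle _; rewrite cramer_entry.
apply: le_trans (ler_wpM2l _ (norm_det_leq _)) _; first exact: prodr_ge0.
rewrite -big_split /= -prodrXr; apply: ler_prod => i _.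
rewrite mulr_ge0 ?sumr_ge0 //=.
(* With [s] the absolute sum of row [i] of [M], the row sum is at most [2 ^ b i + s], hence at most
   [(1 + s) * 2 ^ b i]; and [1 + s] is at most the product by [sum_ltr_prod]. *)
have sum_le : \sum_k `|(\matrix_(i, k) if k == j then y i 0 else ratr (M i k)) i k| 
   <= (\prod_k (1 + `|ratr (M i k) : F|)) * 2 ^+ b i.
  rewrite (bigD1 j) //= mxE eqxx.
  apply: le_trans (lerD (leyb i) (_ : _ <= \sum_k `|ratr (M i k) : F|)) _.
    rewrite [leRHS](bigD1 j) //= -[leLHS]add0r lerD //.
    by apply: ler_sum => k /negPf kj; rewrite mxE kj.
  have := sum_ltr_prod (index_enum 'I_n) predT (fun k => normr_ge0 (ratr (M i k) : F)).
  set s := \sum_k _; set p := \prod_k _; move=> lesp.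
  have b1 : 1 <= 2 ^+ b i :> F by rewrite exprn_ege1 // ler1n.
  have s0 : 0 <= s by apply: sumr_ge0.
  nra.
apply: le_trans (ler_wpM2l (d_ge0 i) sum_le) _.
rewrite mulrA exprD ler_wpM2r ?exprn_ge0 // /d -big_split /=.
apply: (@le_trans _ _ (\prod_k 2 ^+ size_rat (M i k))); last first.
  by rewrite prodrXr ler_eXn2l // ltr1n.
apply: ler_prod => k _; rewrite mulr_ge0 ?ler0z ?addr_ge0 //=.
have := denq_norm_leq (M i k).
by rewrite -(ler_rat F) rmorphM rmorphD /= rmorphXn rmorph1 ratr_norm ratr_int rmorph_nat.
Qed.
End Cramer.

Lemma leq_sum_inj (I J : finType) (f : I -> J) (G : J -> nat) :
  injective f -> (\sum_i G (f i) <= \sum_j G j)%N.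
Proof.
move=> finj; rewrite [leqRHS](bigID (mem [set f i | i in [set: I]])) /=.
rewrite big_imset /=; last by move=> ? ? _ _ /finj.
by rewrite [X in (_ <= X + _)%N](eq_bigl predT) ?leq_addr // => i; rewrite inE.
Qed.

Section Constraints.
Variables (F : realType) (n : nat) (I : instance n).
Hypothesis wfI : well_formed F I.

Definition constraints := col_mx (eqs I) (slabs I).

(** An equation gets slack size 0, for which the bound [2 ^ 0 - 1] is 0. *)
Definition slack_size (k : 'I_(neqs I + nslabs I)) : nat :=
  if split k is inr i then size_rat (widths I i 0) else 0.

Lemma constraints_leq (x : 'cV[F]_n) k : regionD F I x ->
  `|(map_mx ratr constraints *m x) k 0| <= 2 ^+ slack_size k - 1.
Proof.
case: wfI => w_gt0 _ _ [xV xD]; rewrite /slack_size map_col_mx mul_col_mx mxE.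
case: (split k) => i; first by rewrite xV mxE normr0 subrr.
apply: le_trans (xD i) _; rewrite lerBrDl.
have := norm_leq (widths I i 0).
by rewrite gtr0_norm // -(ler_rat F) rmorphD rmorphXn rmorph1 rmorph_nat.
Qed.

(** A nonzero vector annihilated by all constraints would span a line inside D, against boundedness.
    The columns of the cokernel matrix are such vectors. *)
Lemma row_full_constraints : row_full constraints.
Proof.
case: wfI => w_gt0 _ [B boundB].
rewrite -cokermx_eq0 -(map_mx_eq0 (@ratr F)); apply/eqP/matrixP => i j; rewrite [RHS]mxE.
set v := map_mx (@ratr F) (cokermx constraints).
have Av : map_mx ratr constraints *m v = 0 by rewrite -map_mxM mulmx_coker raddf0.
have lineD (c : F) : regionD F I (c *: col j v).
  move: Av; rewrite map_col_mx mul_col_mx -col_mx0 => /eq_col_mx[Ev Uv].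
  split=> [|k].
    by rewrite /subspaceV /= -scalemxAr colE mulmxA Ev mul0mx scaler0.
  rewrite -scalemxAr colE mulmxA Uv mul0mx scaler0 mxE normr0.
  by rewrite -(rmorph0 (@ratr F)) ler_rat ltW.
apply/eqP; apply: contraT => v0.
(* This multiple has entry [|B| + 1], which exceeds the bound [B]. *)
have := boundB _ (lineD ((`|B| + 1) / v i j)) i.
rewrite mxE [col j v i 0]mxE divfK // ger0_norm ?addr_ge0 // => leB.
have := ler_norm B; lra.
Qed.

(** Full column rank supplies n independent constraints for Cramer's rule. They are distinct rows,
    so the exponents add up to at most the encoding length. *)
Lemma region_box (x : 'cV[F]_n) : regionD F I x ->
  forall j, `|x j 0| <= 2 ^+ size_instance I.
Proof.
move=> xD j; pose f := fullrankfun row_full_constraints.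
pose A := rowsub f constraints.
pose w k := (\sum_j size_rat (constraints k j))%N.
have detA : \det A != 0.
  by rewrite -unitfE -unitmxE fullrowsub_unit.
have ley i : `|(map_mx ratr A *m x) i 0| <= 2 ^+ slack_size (f i) - 1.
  rewrite -(_ : (map_mx ratr constraints *m x) (f i) 0 = (map_mx ratr A *m x) i 0).
    exact: constraints_leq.
  by rewrite !mxE; apply: eq_bigr => k _; rewrite !mxE.
have lew i : (\sum_k size_rat (A i k) <= w (f i))%N.
  by apply: leq_sum => k _; rewrite mxE.
apply: le_trans (cramer_bound detA j ley lew) _.
rewrite ler_eXn2l ?ltr1n //.
have finj : injective f by apply: fullrankfun_inj.
apply: leq_trans (leq_sum_inj (fun k => w k + slack_size k)%N finj) _.
rewrite big_split_ord /= /size_instance /slack_size.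
under eq_bigr do rewrite (unsplitK (inl _)) addn0.
under [X in (_ + X <= _)%N]eq_bigr do rewrite (unsplitK (inr _)).
rewrite /w big_split /= -addnA.
apply: (@leq_trans (size_mx (eqs I) + (size_mx (slabs I) + size_mx (widths I)))); last by lia.
apply: leq_add; last apply: leq_add.
- by apply: leq_sum => i _; apply: leq_sum => k _; rewrite col_mxEu.
- by apply: leq_sum => i _; apply: leq_sum => k _; rewrite col_mxEd.
by apply: leq_sum => i _; rewrite big_ord1.
Qed.
End Constraints.

(** * Calls and running times *)

Section Programs.
Variable opt : optimizer.

Lemma run_time_bind A B (p : prog A) (f : A -> prog B) :
  run_time opt (bind p f) = (run_time opt p + run_time opt (f (result opt p)))%N.
Proof.
elim: p => [//|c p IH|o a b g IH|a b g IH|n k g IH] /=; by rewrite IH addnA.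
Qed.

Lemma calls_bind A B (p : prog A) (f : A -> prog B) :
  calls opt (bind p f) = (calls opt p + calls opt (f (result opt p)))%N.
Proof. by elim: p => //= n k g IH; rewrite IH addSn. Qed.

Lemma calls_bind0 A B (p : prog A) (f : A -> prog B) :
  calls opt p = 0%N -> (forall a, calls opt (f a) = 0%N) -> calls opt (bind p f) = 0%N.
Proof. by move=> p0 f0; rewrite calls_bind p0 f0. Qed.

Lemma calls_mapM (J B : Type) (f : J -> prog B) l :
  (forall j, calls opt (f j) = 0%N) -> calls opt (mapM f l) = 0%N.
Proof. by move=> f0; elim: l => //= j l IH; rewrite !calls_bind f0 IH. Qed.

Lemma calls_dotM n (a b : 'I_n -> rat) : calls opt (dotM a b) = 0%N.
Proof. by rewrite /dotM; elim: (enum _) => //= i l IH; rewrite calls_bind IH. Qed.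

Lemma calls_rowM n (f : 'I_n -> prog rat) :
  (forall j, calls opt (f j) = 0%N) -> calls opt (rowM f) = 0%N.
Proof. by move=> f0; rewrite calls_bind calls_mapM. Qed.

Lemma calls_colM n (f : 'I_n -> prog rat) :
  (forall j, calls opt (f j) = 0%N) -> calls opt (colM f) = 0%N.
Proof. by move=> f0; rewrite calls_bind calls_mapM. Qed.

Lemma calls_mxM n (f : 'I_n -> 'I_n -> prog rat) :
  (forall i j, calls opt (f i j) = 0%N) -> calls opt (mxM f) = 0%N.
Proof. by move=> f0; rewrite calls_bind calls_mapM // => i; apply: calls_mapM. Qed.

Lemma calls_pow2M k : calls opt (pow2M k) = 0%N.
Proof. by elim: k => //= k IH; rewrite calls_bind IH. Qed.

Lemma calls_pull_slab n w w4 (delta : 'cV[rat]_n) a b :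
  calls opt (pull_slab w w4 delta a b) = 0%N.
Proof. by rewrite /pull_slab /pull_ineq !(calls_bind, calls_rowM, calls_dotM). Qed.

Lemma calls_cell_query n (I : instance n) w r delta :
  calls opt (cell_query I w r delta) = 0%N.
Proof.
apply: calls_bind0 => // w4.
apply: calls_bind0 => [|Ke]; first by apply: calls_mapM => i; apply: calls_pull_slab.
apply: calls_bind0 => [|Ks]; first by apply: calls_mapM => i; apply: calls_pull_slab.
apply: calls_bind0 => [|Qh]; first exact: calls_mxM.
apply: calls_bind0 => [|Qd]; first by apply: calls_colM => i; apply: calls_dotM.
apply: calls_bind0 => [|ch]; first exact: calls_colM.
by apply: calls_bind0 => //; apply: calls_dotM.
Qed.

Lemma calls_eval_objective n (k : query n) z : calls opt (eval_objective k z) = 0%N.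
Proof.
apply: calls_bind0 => [|Qz]; first by apply: calls_colM => i; apply: calls_dotM.
by do 2![apply: calls_bind0 => [|?]; first exact: calls_dotM].
Qed.

Lemma calls_witness n w (delta z : 'cV[rat]_n) : calls opt (witness w delta z) = 0%N.
Proof. by rewrite /witness calls_bind calls_colM. Qed.

Local Opaque cell_query eval_objective witness.

Lemma calls_search_cells n (I : instance n) w r ds :
  (calls opt (search_cells I w r ds) <= size ds)%N.
Proof.
elim: ds => //= delta ds IH; rewrite calls_bind calls_cell_query /= ltnS.
case: answer => // z; rewrite calls_bind calls_eval_objective /=.
by case: ifP => // _; rewrite calls_bind calls_witness.
Qed.

Lemma card_digit n : #|{: digit n}| = (4 ^ n)%N.
Proof. by rewrite card_ffun !card_ord. Qed.

Lemma calls_search_levels n (I : instance n) r s :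
  (calls opt (search_levels I r s) <= s * 4 ^ n)%N.
Proof.
elim: s => //= s IH; rewrite calls_bind calls_pow2M add0n calls_bind mulSn leq_add //.
  by rewrite (leq_trans (calls_search_cells _ _ _ _)) // -cardE card_digit.
by case: (result _ _) => [d|] //.
Qed.

Lemma run_time_mapM (J : finType) (B : Type) (f : J -> prog B) T :
  (forall j, run_time opt (f j) <= T)%N ->
  (run_time opt (mapM f (enum J)) <= #|J| * T.+1)%N.
Proof.
rewrite cardE => leT; elim: (enum J) => //= j l IH.
by have := leT j; rewrite !run_time_bind /= mulSn; lia.
Qed.

Lemma run_time_rowM n (f : 'I_n -> prog rat) T :
  (forall j, run_time opt (f j) <= T)%N -> (run_time opt (rowM f) <= n * T.+1)%N.
Proof. by move=> /run_time_mapM; rewrite run_time_bind addn0 card_ord. Qed.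

Lemma run_time_colM n (f : 'I_n -> prog rat) T :
  (forall j, run_time opt (f j) <= T)%N -> (run_time opt (colM f) <= n * T.+1)%N.
Proof. by move=> /run_time_mapM; rewrite run_time_bind addn0 card_ord. Qed.

Lemma run_time_mxM n (f : 'I_n -> 'I_n -> prog rat) T :
  (forall i j, run_time opt (f i j) <= T)%N ->
  (run_time opt (mxM f) <= n * (n * T.+1).+1)%N.
Proof.
move=> leT; rewrite run_time_bind addn0 -[X in (_ <= X * _)%N]card_ord.
by apply: run_time_mapM => i; rewrite -[X in (_ <= X * _)%N]card_ord; apply: run_time_mapM.
Qed.

Lemma fits_pow2 k : fits k.+1 (2 ^+ k).
Proof.
have -> : 2 ^+ k = (2 ^ k)%N%:Z%:~R :> rat by rewrite -pmulrn natrX.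
by apply: fits_int => //; rewrite absz_nat ltn_exp2l.
Qed.

Lemma run_time_pow2M k : (run_time opt (pow2M k) <= k * ((5 + 4 * k) ^ 2).+1)%N.
Proof.
elim: k => //= k IH; rewrite run_time_bind /= result_pow2M addn0.
have := op_cost_leq (fits_pow2 k) (fits_pow2 k); move: (op_cost _ _) => c lec.
apply: (@leq_trans (1 + (k * ((5 + 4 * k.+1) ^ 2).+1 + (5 + 4 * k.+1) ^ 2))); last by lia.
rewrite leq_add // leq_add //; apply: leq_trans IH _.
by rewrite leq_mul // ltnS leq_exp2r //; lia.
Qed.
End Programs.

Lemma cramer_bounding_correct (F : realType) opt : bounding_spec F opt 10 cramer_bounding.
Proof.
move=> n I n0 wfI; rewrite /cramer_bounding; have box := region_box wfI.
have phi1 : (0 < size_instance I)%N by [].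
move: (size_instance I) phi1 box => phi phi1 box /=.
have numR : numq (2 ^+ phi) = 2 ^+ phi.
  have -> : 2 ^+ phi = (2 ^+ phi : int)%:~R :> rat by rewrite rmorphXn rmorph_nat.
  exact: numq_int.
rewrite !result_bind result_pow2M !run_time_bind !calls_bind calls_pow2M /= numR.
have phiX : (phi.+1 <= (1 + phi) ^ 10)%N by rewrite -[leqLHS]expn1 leq_exp2l.
split=> //.
- split=> [|x xD j]; first by rewrite exprn_ege1.
  by rewrite rmorphXn; apply: box.
- by rewrite ltr_eXn2l.
- split=> //; apply: leq_trans phiX; rewrite up_log_min //.
  have -> : 2 ^+ phi = (2 ^ phi)%N :> int by rewrite -natz natrX.
  by have := expn_gt0 2 phi; rewrite expnS; lia.
rewrite addn0; apply: leq_trans (leq_add (leqnn phi) (run_time_pow2M _ _)) _.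
(* The exponent 10 is 7 + 3: the doubling loop costs a cubic polynomial in [phi], and its constant
   [2 ^ 7] is at most [(1 + phi) ^ 7] because [phi] is positive. *)
apply: (@leq_trans (2 ^ 7 * (1 + phi) ^ 3)); last first.
  by rewrite [X in (_ <= _ ^ X)%N](_ : _ = 7 + 3)%N // expnD leq_mul // leq_exp2r.
by move: phi phi1 {box numR phiX} => p p1; rewrite !expnS !expn0; nia.
Qed.

(** [M] will bound the dimension, the numbers of constraints, and the bit lengths of the input, of
    [w], [delta] and [z]. A dot product multiplies lengths by about [M], and a value of the
    objective nests two of them, hence the cube. *)
Definition number_bits (M : nat) : nat := (64 * (M * M * M))%N.

Definition op_bound (M : nat) : nat := ((5 + 4 * number_bits M) ^ 2)%N.

(** * Bit lengths and running time within one cell *)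

Section CellTime.
Variables (opt : optimizer) (n M : nat).
Hypotheses (M_gt1 : (1 < M)%N) (le_nM : (n <= M)%N).

Local Notation L := (number_bits M).
Local Notation W := (op_bound M).

Lemma op_cost_bound a b : fits L a -> fits L b -> (op_cost a b <= W)%N.
Proof. exact: op_cost_leq. Qed.

Lemma fits_dot A B (a b : 'I_n -> rat) :
  (forall i, fits A (a i)) -> (forall i, fits B (b i)) ->
  fits (n * (A + B).+1).+1 (\sum_i a i * b i).
Proof.
move=> fa fb; rewrite -[X in (X * _)%N](size_enum_ord n) -big_enum.
by apply: fits_sum => i; apply: fitsM.
Qed.

(** The length bound for the full sum covers all partial sums, so both operations of each round cost
    at most [W]. *)
Lemma run_time_sum_mulM A B (J : Type) (a b : J -> rat) l :
  (forall i, fits A (a i)) -> (forall i, fits B (b i)) ->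
  ((size l * (A + B).+1).+1 <= L)%N ->
  (run_time opt (sum_mulM a b l) <= size l * (2 * W).+1)%N.
Proof.
move=> fa fb; elim: l => //= i l IH; rewrite mulSn => leL.
have leL' : ((size l * (A + B).+1).+1 <= L)%N by lia.
have fs : fits L (result opt (sum_mulM a b l)).
  have -> : result opt (sum_mulM a b l) = \sum_(i <- l) a i * b i.
    elim: l {IH leL leL'} => [|j l IH]; first by rewrite big_nil.
    by rewrite big_cons /= !result_bind /= IH addrC.
  by apply: fits_leq leL' _; apply: fits_sum => j; apply: fitsM.
have fp : fits L (a i * b i) by apply: fits_leq (fitsM (fa i) (fb i)); lia.
have fa' : fits L (a i) by apply: fits_leq (fa i); lia.
have fb' : fits L (b i) by apply: fits_leq (fb i); lia.
rewrite !run_time_bind /=.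
have := op_cost_bound fa' fb'; have := op_cost_bound fp fs; have := IH leL'.
by rewrite mulSn; lia.
Qed.

Lemma run_time_dotM A B (a b : 'I_n -> rat) :
  (forall i, fits A (a i)) -> (forall i, fits B (b i)) ->
  ((n * (A + B).+1).+1 <= L)%N -> (run_time opt (dotM a b) <= n * (2 * W).+1)%N.
Proof.
by move=> fa fb; have := run_time_sum_mulM (l := enum 'I_n) fa fb; rewrite size_enum_ord.
Qed.

Let M2 : (M * 2 <= M * M)%N. Proof. by rewrite leq_mul2l M_gt1 orbT. Qed.
Let M3 : (M * M * 2 <= M * M * M)%N. Proof. by rewrite leq_mul2l M_gt1 orbT. Qed.

Let le_nMl k : (n * k <= M * k)%N. Proof. by rewrite leq_mul2r le_nM orbT. Qed.

Variables (w : rat) (delta : 'cV[rat]_n).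
Hypotheses (fw : fits M w) (fdelta : forall i, fits M (delta i 0)).

Let fits_4 : fits 3 4. Proof. by []. Qed.
Let fits_8 : fits 4 8. Proof. by []. Qed.
Let fits_16 : fits 5 16. Proof. by []. Qed.
Let fw4 : fits (M + 3) (4 * w). Proof. by rewrite addnC; apply: fitsM. Qed.

Let T1 := (n * W.+1 + n * (2 * W).+1 + 2 * W)%N.

Lemma fits_pulled (a : 'rV[rat]_n) b :
  (forall j, fits M (a 0 j)) -> fits M b ->
  (forall j, fits L ((pulled w delta a b).1 0 j)) /\ fits L (pulled w delta a b).2.
Proof.
move=> fa fb; split=> [j|] /=.
  rewrite mxE; apply: fits_leq (fitsM fw4 (fa j)); rewrite /number_bits; lia.
rewrite mxE; apply: fits_leq (fitsD fb _); last first.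
  by rewrite fitsN; apply: fitsM fw _; apply: fits_dot fa fdelta.
have := le_nMl (M + M).+1; rewrite /number_bits; lia.
Qed.

Lemma run_time_pull_ineq (a : 'rV[rat]_n) b :
  (forall j, fits M (a 0 j)) -> fits M b ->
  (run_time opt (pull_ineq w (4 * w) delta a b) <= T1)%N.
Proof.
move=> fa fb; have leL := le_nMl (M + M).+1; have fd := fits_dot fa fdelta.
rewrite /pull_ineq (run_time_bind _ (rowM _)) (run_time_bind _ (dotM _ _)) result_dotM.
rewrite /= addn0 /T1 -!addnA.
apply: leq_add.
  apply: run_time_rowM => j; rewrite /= addn0.
  by apply: op_cost_bound; [apply: fits_leq fw4 | apply: fits_leq (fa j)]; rewrite /number_bits; lia.
apply: leq_add.
  by apply: run_time_dotM fa fdelta _; rewrite /number_bits; lia.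
rewrite mul2n -addnn; apply: leq_add.
  by apply: op_cost_bound; [apply: fits_leq fw | apply: fits_leq fd]; rewrite /number_bits; lia.
apply: op_cost_bound; [apply: fits_leq fb | apply: fits_leq (fitsM fw fd)]; rewrite /number_bits; lia.
Qed.

Lemma run_time_pull_slab (a : 'rV[rat]_n) b :
  (forall j, fits M (a 0 j)) -> fits M b ->
  (run_time opt (pull_slab w (4 * w) delta a b) <= 2 * T1 + n * W.+1)%N.
Proof.
move=> fa fb; rewrite /pull_slab (run_time_bind _ (pull_ineq _ _ _ _ _)) (run_time_bind _ (rowM _)).
rewrite (run_time_bind _ (pull_ineq _ _ _ _ _)) result_rowM /= addn0.
have fna j : fits M ((\row_j (0 - a 0 j)) 0 j) by rewrite mxE sub0r fitsN.
have h1 := run_time_pull_ineq fa fb; have h2 := run_time_pull_ineq fna fb.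
have h3 : (run_time opt (rowM (fun j => subM 0%R (a 0%R j))) <= n * W.+1)%N.
  apply: run_time_rowM => j; rewrite /= addn0.
  by apply: op_cost_bound; [apply: fits_leq fits0 | apply: fits_leq (fa j)]; rewrite /number_bits; lia.
by apply: leq_trans (leq_add h1 (leq_add h3 h2)) _; rewrite mul2n -addnn addnCA addnC.
Qed.

Variable I : instance n.
Hypotheses (fE : forall i j, fits M (eqs I i j)) (fU : forall i j, fits M (slabs I i j)).
Hypotheses (fr : forall i, fits M (widths I i 0)) (fQ : forall i j, fits M (formQ I i j)).
Hypotheses (leE : (neqs I <= M)%N) (leU : (nslabs I <= M)%N).

Let W_gt0 : (0 < W)%N. Proof. by rewrite expn_gt0. Qed.
Let nW : (n * W <= M * W)%N. Proof. exact: le_nMl. Qed.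
Let MW_n : (M <= M * W)%N. Proof. by rewrite leq_pmulr. Qed.
Let MW_W : (W * 2 <= M * W)%N. Proof. by rewrite mulnC leq_mul2r M_gt1 orbT. Qed.
Let MMW : (M * W * 2 <= M * M * W)%N.
Proof. by have := leq_mul M_gt1 (leqnn (M * W)); lia. Qed.
Let scale_MW m x k : (m <= M)%N -> (x <= k * (M * W))%N -> (m * x <= k * (M * M * W))%N.
Proof. by move=> lem lex; rewrite -mulnA mulnCA leq_mul. Qed.

Let fits_Qd i : fits (n * (M + M).+1).+1 ((formQ I *m delta) i 0).
Proof. by rewrite mxE; apply: fits_dot => // j; apply: fQ. Qed.

(** The two loops over the constraints have at most [M] rounds of O(M) operations each, the
    objective takes O(M^2) operations, and every operation costs at most [W]. *)
Lemma run_time_cell_query r :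
  (run_time opt (cell_query I w r delta) <= 45 * (M * M * W))%N.
Proof.
rewrite /cell_query (run_time_bind _ (mulM _ _)) !(run_time_bind _ (mapM _ _)).
rewrite (run_time_bind _ (mxM _)) !(run_time_bind _ (colM _)) (run_time_bind _ (dotM _ _)).
do 2!rewrite result_colM.
have rE : (run_time opt (mapM (fun i => pull_slab w (4 * w) delta (row i (eqs I)) 0%R)
  (enum 'I_(neqs I))) <= neqs I * (2 * T1 + n * W.+1).+1)%N.
  rewrite -[X in (_ <= X * _)%N]card_ord; apply: run_time_mapM => i.
  apply: run_time_pull_slab => [j|]; first by rewrite mxE.
  by apply: fits_leq fits0; lia.
have rU : (run_time opt (mapM (fun i => pull_slab w (4 * w) delta (row i (slabs I)) (widths I i 0%R))
  (enum 'I_(nslabs I))) <= nslabs I * (2 * T1 + n * W.+1).+1)%N.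
  rewrite -[X in (_ <= X * _)%N]card_ord; apply: run_time_mapM => i.
  by apply: run_time_pull_slab => // j; rewrite mxE.
have leL := le_nMl (M + M).+1.
have rQ : (run_time opt (mxM (fun i j => mulM 16%:R%R (formQ I i j))) <= n * (n * W.+1).+1)%N.
  apply: run_time_mxM => i j; rewrite /= addn0.
  by apply: op_cost_bound; [apply: fits_leq fits_16 | apply: fits_leq (fQ i j)]; rewrite /number_bits; lia.
have rd : (run_time opt (colM (fun i => dotM (formQ I i) (delta^~ 0%R))) <= n * (n * (2 * W).+1).+1)%N.
  apply: run_time_colM => i; apply: run_time_dotM (fQ i) fdelta _; rewrite /number_bits; lia.
set Qd := \col_j _.
have fd i : fits (n * (M + M).+1).+1 (Qd i 0).
  by rewrite mxE result_dotM; apply: fits_dot.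
have rc : (run_time opt (colM (fun i => mulM 8%:R%R (Qd i 0%R))) <= n * W.+1)%N.
  apply: run_time_colM => i; rewrite /= addn0.
  by apply: op_cost_bound; [apply: fits_leq fits_8 | apply: fits_leq (fd i)]; rewrite /number_bits; lia.
have rg : (run_time opt (dotM (delta^~ 0%R) (Qd^~ 0%R)) <= n * (2 * W).+1)%N.
  apply: run_time_dotM fdelta fd _.
  have := le_nMl (M + (n * (M + M).+1).+1).+1; have := leq_mul (leqnn M) leL.
  rewrite /number_bits; lia.
have r4 : (run_time opt (mulM 4%:R%R w) <= W)%N.
  by rewrite /= addn0; apply: op_cost_bound; [apply: fits_leq fits_4 | apply: fits_leq fw]; rewrite /number_bits; lia.
have leT : (2 * T1 + n * W.+1 <= 14 * (M * W))%N by rewrite /T1; lia.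
have bE : (neqs I * (2 * T1 + n * W.+1).+1 <= 15 * (M * M * W))%N by apply: scale_MW => //; lia.
have bU : (nslabs I * (2 * T1 + n * W.+1).+1 <= 15 * (M * M * W))%N by apply: scale_MW => //; lia.
have bQ : (n * (n * W.+1).+1 <= 3 * (M * M * W))%N by apply: scale_MW => //; lia.
have bd : (n * (n * (2 * W).+1).+1 <= 4 * (M * M * W))%N by apply: scale_MW => //; lia.
apply: leq_trans (leq_add r4 (leq_add rE (leq_add rU (leq_add rQ (leq_add rd (leq_add rc (leq_add rg (leqnn 0)))))))) _.
lia.
Qed.

(** The radius 0 is a placeholder: the objective data do not depend on it. *)
Let fits_c i : fits (4 + (n * (M + M).+1).+1) ((obj_c (cell_data I w 0 delta)) i 0).
Proof. by rewrite mxE; apply: fitsM. Qed.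

Let fits_g : fits (n * (M + (n * (M + M).+1).+1).+1).+1 (obj_g (cell_data I w 0 delta)).
Proof.
rewrite /= -mulmxA mxE; apply: fits_dot => // i; by rewrite mxE.
Qed.

Let fits_Qh i j : fits (5 + M) ((obj_Q (cell_data I w 0 delta)) i j).
Proof. by rewrite mxE; apply: fitsM. Qed.

Lemma size_cell_data r : (`|r| < 2 ^ M)%N ->
  (size_query (cell_data I w r delta) <= 64 * (M * M * L))%N.
Proof.
move=> ltr; rewrite /size_query; set k := cell_data I w r delta.
have leL := le_nMl (M + M).+1.
have leL2 := le_nMl (M + (n * (M + M).+1).+1).+1; have leL3 := leq_mul (leqnn M) leL.
have s_n : (size_nat n <= M.+1)%N.
  by rewrite size_nat_leq // (leq_ltn_trans le_nM) // ltn_expl.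
have s_r : (size_nat `|radius k| <= M.+1)%N by apply: size_nat_leq.
have s_Q : (size_mx (obj_Q k) <= n * (n * L.+1.*2))%N.
  by apply: size_mx_leq => i j; apply: fits_leq (fits_Qh i j); rewrite /number_bits; lia.
have s_c : (size_mx (obj_c k) <= n * (1 * L.+1.*2))%N.
  by apply: size_mx_leq => i j; rewrite ord1; apply: fits_leq (fits_c i); rewrite /number_bits; lia.
have s_g : (size_rat (obj_g k) <= L.+1.*2)%N.
  by apply: size_rat_leq; apply: fits_leq fits_g; rewrite /number_bits; lia.
(* Each equation or slab contributes two inequalities, each made of n + 1 numbers that fit in [L]
   bits. *)
have s_K : (\sum_(ab <- ineqs k) (size_mx ab.1 + size_rat ab.2) <=
   (neqs I + nslabs I).*2 * (n * L.+1.*2 + L.+1.*2))%N.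
  have <- : size (ineqs k) = (neqs I + nslabs I).*2.
    have size_pairs (J : Type) (T : Type) (f g : J -> T) s :
        size (flatten [seq [:: f i; g i] | i <- s]) = (size s).*2.
      by elim: s => //= i s ->.
    by rewrite size_cat !size_pairs !size_enum_ord doubleD.
  have lpull (a : 'rV[rat]_n) b : (forall j, fits M (a 0 j)) -> fits M b ->
      (size_mx (pulled w delta a b).1 + size_rat (pulled w delta a b).2 <= n * L.+1.*2 + L.+1.*2)%N.
    move=> fa fb; have [f1 f2] := fits_pulled fa fb.
    rewrite leq_add ?size_rat_leq // -[X in (_ <= X)%N]mul1n.
    by apply: size_mx_leq => i j; rewrite ord1.
  have f0 : fits M 0 by apply: fits_leq fits0; lia.
  rewrite -sum1_size big_distrl /= ![X in (X <= _)%N]big_seq ![X in (_ <= X)%N]big_seq.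
  apply: leq_sum => ab; rewrite mul1n mem_cat.
  case/orP=> /flatten_mapP[i _]; rewrite !inE => /orP[] /eqP-> ; apply: lpull => // j;
  by rewrite !mxE ?fitsN.
have nn : (n * n <= M * M)%N by apply: leq_mul.
have L1 : (L.+1.*2 <= 4 * L)%N by rewrite -muln2 /number_bits; lia.
set S := (L.+1.*2) in s_Q s_c s_g s_K L1.
apply: (@leq_trans (M.+1 + (M + M).*2 * (M * S + S) + M * (M * S) + M * (1 * S) + S + M.+1)).
  rewrite !leq_add //.
  - by apply: leq_trans s_K _; rewrite leq_mul ?leq_double ?leq_add ?leq_mul.
  - by apply: leq_trans s_Q _; rewrite !leq_mul.
  - by apply: leq_trans s_c _; rewrite !leq_mul.
apply: (@leq_trans (8 * (M * M * S) + 2 * (M * M * L))); last first.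
  by have := leq_mul (leqnn (M * M)) L1; clearbody S; lia.
have := leq_mul M_gt1 (leqnn (M * S)); have := leq_mul M_gt1 (leqnn S).
have := leq_mul (leqnn (M * M)) (_ : 1 <= L)%N.
have : (1 <= L)%N by rewrite /number_bits; lia.
rewrite -!muln2; clearbody S => L0 /(_ L0) *; lia.
Qed.

Lemma result_eval_objective (k : query n) (z : 'cV[rat]_n) :
  result opt (eval_objective k z) =
  \sum_i z i 0 * (\sum_j obj_Q k i j * z j 0) + \sum_i obj_c k i 0 * z i 0 + obj_g k.
Proof.
rewrite /eval_objective (result_bind _ (colM _)) !(result_bind _ (dotM _ _)).
rewrite !result_dotM result_colM /=; congr (_ + _ + _); apply: eq_bigr => i _.
by rewrite mxE result_dotM.
Qed.

Variable z : 'cV[rat]_n.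
Hypothesis fz : forall i, fits M (z i 0).

(** The extra [op_cost] pays for the sign test that follows the evaluation in [search_cells]. *)
Lemma run_time_eval_objective r :
  (run_time opt (eval_objective (cell_data I w r delta) z) +
   op_cost (result opt (eval_objective (cell_data I w r delta) z)) 0%R
   <= 9 * (M * M * W))%N.
Proof.
set k := cell_data I w r delta.
have fQz i : fits (n * (5 + M + M).+1).+1 (\sum_j obj_Q k i j * z j 0).
  by apply: fits_dot => // j; apply: fits_Qh.
have fe2 : fits (n * (M + (n * (5 + M + M).+1).+1).+1).+1 (\sum_i z i 0 * \sum_j obj_Q k i j * z j 0).
  exact: fits_dot.
have fe1 : fits (n * (4 + (n * (M + M).+1).+1 + M).+1).+1 (\sum_i obj_c k i 0 * z i 0).
  exact: fits_dot.
have fe := fitsD fe2 fe1; have fv := fitsD fe fits_g.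
(* This is the length of the final value. The lengths of the intermediate results are summands of
   it, so their bounds follow. *)
have leV : ((((n * (M + (n * (5 + M + M).+1).+1).+1).+1 +
  (n * (4 + (n * (M + M).+1).+1 + M).+1).+1).+1 +
  (n * (M + (n * (M + M).+1).+1).+1).+1).+1 <= L)%N.
  apply: (@leq_trans ((((M * (M + (M * (5 + M + M).+1).+1).+1).+1 +
    (M * (4 + (M * (M + M).+1).+1 + M).+1).+1).+1 +
    (M * (M + (M * (M + M).+1).+1).+1).+1).+1)).
    by do ![apply: leq_add | apply: leq_mul | rewrite ltnS | by []].
  by clear -M_gt1 M2 M3; rewrite /number_bits; lia.
have leV1 := leq_trans (leqW (leq_addr _ _)) leV; have leVg := leq_trans (leqW (leq_addl _ _)) leV.
have leVe2 := leq_trans (leqW (leq_addr _ _)) leV1; have leVe1 := leq_trans (leqW (leq_addl _ _)) leV1.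
have L_gt0 : (0 < L)%N by apply: leq_trans leV.
have toL m a : fits m a -> (m <= L)%N -> fits L a by move=> fa lem; apply: fits_leq fa.
rewrite result_eval_objective.
rewrite /eval_objective (run_time_bind _ (colM _)) !(run_time_bind _ (dotM _ _)).
rewrite !result_dotM result_colM; set Qz := \col_j _.
have eQz i : Qz i 0 = \sum_j obj_Q k i j * z j 0 by rewrite mxE result_dotM.
have -> : \sum_i z i 0 * Qz i 0 = \sum_i z i 0 * \sum_j obj_Q k i j * z j 0.
  by apply: eq_bigr => i _; rewrite eQz.
have fQz' i : fits (n * (5 + M + M).+1).+1 (Qz i 0) by rewrite eQz.
have t1 : (run_time opt (colM (fun i => dotM (obj_Q k i) (z^~ 0%R))) <= n * (n * (2 * W).+1).+1)%N.
  apply: run_time_colM => i; apply: run_time_dotM (fits_Qh i) fz _.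
  by have := le_nMl (5 + M + M).+1; clear -M_gt1 M2 M3; rewrite /number_bits; lia.
have t2 : (run_time opt (dotM (z^~ 0%R) (Qz^~ 0%R)) <= n * (2 * W).+1)%N.
  by apply: run_time_dotM fz fQz' _.
have t3 : (run_time opt (dotM ((obj_c k)^~ 0%R) (z^~ 0%R)) <= n * (2 * W).+1)%N.
  by apply: run_time_dotM fits_c fz _.
rewrite /= addn0.
have t4 := op_cost_bound (toL _ _ fe2 leVe2) (toL _ _ fe1 leVe1).
have t5 := op_cost_bound (toL _ _ fe leV1) (toL _ _ fits_g leVg).
have t6 := op_cost_bound (toL _ _ fv leV) (toL _ _ fits0 L_gt0).
have b1 : (n * (n * (2 * W).+1).+1 <= 4 * (M * M * W))%N.
  by apply: scale_MW => //; clear -nW MW_n le_nM M_gt1; lia.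
apply: leq_trans (leq_add (leq_add t1 (leq_add t2 (leq_add t3 (leq_add t4 t5)))) t6) _.
by clear -b1 nW MW_n MW_W MMW le_nM M_gt1; lia.
Qed.

Lemma run_time_witness : (run_time opt (witness w delta z) <= 2 * (M * M * W))%N.
Proof.
rewrite /witness run_time_bind addn0.
have t i : (run_time opt (let! e := mulM 4%:R%R (z i 0%R) in
                          let! e' := addM (delta i 0%R) e in mulM w e') <= W + (W + W))%N.
  rewrite /= addn0; have f1 := fitsM fits_4 (fz i); have f2 := fitsD (fdelta i) f1.
  apply: leq_add; last apply: leq_add; apply: op_cost_bound.
  - by apply: fits_leq fits_4; rewrite /number_bits; lia.
  - by apply: fits_leq (fz i); rewrite /number_bits; lia.
  - by apply: fits_leq (fdelta i); rewrite /number_bits; lia.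
  - by apply: fits_leq f1; rewrite /number_bits; lia.
  - by apply: fits_leq fw; rewrite /number_bits; lia.
  by apply: fits_leq f2; rewrite /number_bits; lia.
apply: leq_trans (run_time_colM t) _.
by clear -nW MW_n MMW le_nM; lia.
Qed.
End CellTime.

(** * Correctness of one level *)

Section Level.
Variables (F : realType) (n : nat) (I : instance n).

Lemma real_vecD (u v : 'cV[int]_n) : real_vec F (u + v) = real_vec F u + real_vec F v.
Proof. exact: map_mxD. Qed.

Lemma real_vecB (u v : 'cV[int]_n) : real_vec F (u - v) = real_vec F u - real_vec F v.
Proof. exact: map_mxB. Qed.

Lemma real_vecZ (a : int) (v : 'cV[int]_n) : real_vec F (a *: v) = a%:~R *: real_vec F v.
Proof. exact: map_mxZ. Qed.

Lemma quadZ (Q : 'M[rat]_n) (a : F) x : quad Q (a *: x) = a ^+ 2 * quad Q x.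
Proof. by rewrite /quad -scalemxAr [(a *: x)^T]linearZ /= -!scalemxAl scalerA mxE expr2. Qed.

Lemma quad_scale (Q : 'M[rat]_n) (a : rat) (x : 'cV[F]_n) : quad (a *: Q) x = ratr a * quad Q x.
Proof. by rewrite /quad map_mxZ -scalemxAr -scalemxAl mxE. Qed.

(** D is convex and symmetric, and this point is the midpoint of [x] and [- y]. *)
Lemma region_midpoint (x y : 'cV[F]_n) :
  regionD F I x -> regionD F I y -> regionD F I (2^-1 *: (x - y)).
Proof.
case=> xV xD [yV yD]; split=> [|i].
  by rewrite /subspaceV /= -scalemxAr mulmxBr xV yV subrr scaler0.
rewrite -scalemxAr mulmxBr !mxE normrM ger0_norm ?invr_ge0 //.
rewrite -[ratr _](mulKf (_ : 2 != 0)) ?pnatr_eq0 // ler_pM2l ?invr_gt0 //.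
have := lerD (xD i) (yD i); rewrite mulr_natl mulr2n.
by apply: le_trans; apply: le_trans (ler_normB _ _) _; rewrite !mxE.
Qed.

Definition digit_int (delta : digit n) : 'cV[int]_n := \col_i (delta i)%:Z.

Lemma cell_pointE delta z :
  cell_point (digit_vec delta) (real_vec F z) = real_vec F (digit_int delta + 4 *: z).
Proof.
rewrite real_vecD real_vecZ; congr (_ + _ *: _).
by apply/colP => i; rewrite !mxE ratr_nat -pmulrn.
Qed.

Lemma digit_divE (v : 'cV[int]_n) : exists delta z, v = digit_int delta + 4 *: z.
Proof.
exists [ffun i => inord (absz (modz (v i 0) 4))], (\col_i divz (v i 0) 4).
apply/colP => i; rewrite !mxE ffunE inordK.
  by rewrite gez0_abs ?modz_ge0 // addrC mulrC -divz_eq.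
by rewrite -ltz_nat gez0_abs ?modz_ge0 // ltz_pmod.
Qed.

(** The points of D in 2^s Z^n are written 2^s v; the sign is tested at v, since q(2^s v) = 4^s
    q(v). *)
Definition nonneg_level s := forall v : 'cV[int]_n,
  regionD F I (2 ^+ s *: real_vec F v) -> 0 <= quad (formQ I) (real_vec F v).

Definition nonneg_cell s delta := forall z : 'cV[int]_n,
  let v := digit_int delta + 4 *: z in
  regionD F I (2 ^+ s *: real_vec F v) -> 0 <= quad (formQ I) (real_vec F v).

Lemma nonneg_cells s : (forall delta, nonneg_cell s delta) -> nonneg_level s.
Proof. by move=> cells v; have [delta [z ->]] := digit_divE v; apply: cells. Qed.

Variable R : int.
Hypotheses (wfI : well_formed F I) (R_ge1 : 1 <= R).
Hypothesis boxR : forall x, regionD F I x -> in_box R x.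

(** A nonzero integer entry, once scaled, is at least [2 ^+ s] in absolute value and leaves the box;
    only the zero vector remains. *)
Lemma nonneg_top s : R < 2 ^+ s -> nonneg_level s.
Proof.
move=> ltR v vD; suff -> : v = 0.
  by rewrite /quad /real_vec raddf0 mulmx0 mxE.
apply/colP => i; rewrite [RHS]mxE; apply/eqP; apply: contraTT ltR => v0.
have := boxR vD i; rewrite !mxE -leNgt normrM normrX normr_nat.
rewrite -intr_norm -[2 : F]/(2%:~R) -rmorphXn -rmorphM ler_int; apply: le_trans.
by rewrite ler_peMr ?exprn_ge0 -?gtz0_ge1 ?normr_gt0.
Qed.

Local Notation cell s delta := (cell_data I (2 ^+ s) (R + 1) (digit_vec delta)).

Lemma cellP s delta (z : 'cV[int]_n) :
  polyhedron F (cell s delta) (real_vec F z) <->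
  regionD F I (2 ^+ s *: real_vec F (digit_int delta + 4 *: z)).
Proof. by rewrite cell_dataP rmorphXn rmorph_nat cell_pointE. Qed.

Lemma cell_admissible s delta : nonneg_level s.+1 -> admissible F (cell s delta).
Proof.
move=> nonneg; have [_ symQ _] := wfI.
(* Dropping the factor 2^s gives |delta_i + 4 z_i| <= R with delta_i between 0 and 3. All real
   points are covered, so this yields both the boundedness and the radius; [R + 1] is at least 2, as
   the optimizer demands. *)
have box z : polyhedron F (cell s delta) z -> forall i, `|z i 0| <= R%:~R + 1.
  rewrite cell_dataP rmorphXn rmorph_nat => /boxR zR i.
  have := zR i; rewrite !mxE ratr_nat normrM normrX normr_nat => leR.
  have p1 : 1 <= 2 ^+ s :> F by rewrite exprn_ege1 // ler1n.
  have lt4 : (delta i)%:R <= 3 :> F by rewrite ler_nat -ltnS.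
  have d0 : 0 <= (delta i)%:R :> F by [].
  have R1 : 1 <= R%:~R :> F by rewrite -[1]/(1%:~R) ler_int.
  have {}leR : `|(delta i)%:R + 4 * z i 0| <= R%:~R.
    by apply: le_trans leR; rewrite ler_peMl.
  move: leR; rewrite !ler_norml => /andP[h1 h2]; apply/andP; split; lra.
split.
- by exists (R%:~R + 1) => z /box.
- by rewrite /= linearZ /= symQ.
(* The digits cancel: half of 2^s (delta + 4y) - 2^s (delta + 4x) is 2^(s+1) (y - x), a point of the
   level above. The factor 16 of the form is positive. *)
- move=> x y /cellP xD /cellP yD; rewrite quad_scale rmorph_nat mulr_ge0 //.
  rewrite -real_vecB; apply: nonneg.
  have := region_midpoint yD xD; rewrite -scalerBr -real_vecB scalerA.
  have -> : digit_int delta + 4 *: y - (digit_int delta + 4 *: x) = 4 *: (y - x).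
    by rewrite opprD addrACA subrr add0r scalerBr.
  rewrite real_vecZ !scalerA -pmulrn.
  by congr (regionD F I (_ *: _)); rewrite exprS; lra.
- by rewrite /=; lia.
by move=> x /box xR i; rewrite rmorphD /=; apply: xR.
Qed.

(** This links the sign test, made on rationals, to the real objective of the specification. *)
Lemma objective_evalE opt (k : query n) (z : 'cV[int]_n) :
  ratr (result opt (eval_objective k (map_mx intr z))) = objective k (real_vec F z).
Proof.
rewrite result_eval_objective !rmorphD !rmorph_sum /= /objective /quad -mulmxA !mxE.
congr (_ + _ + _); apply: eq_bigr => i _; rewrite !mxE rmorphM /= ?ratr_int //.
congr (_ * _); rewrite rmorph_sum; apply: eq_bigr => j _.
by rewrite !mxE rmorphM /= ?ratr_int.
Qed.

Lemma real_witness opt s delta (z : 'cV[int]_n) :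
  real_vec F (result opt (witness (2 ^+ s) (digit_vec delta) (map_mx intr z))) =
  2 ^+ s *: real_vec F (digit_int delta + 4 *: z).
Proof.
rewrite /witness result_bind result_colM /=.
apply/colP => i; rewrite !mxE.
have -> : 2 ^+ s * ((delta i)%:R + 4 * (z i 0)%:~R) =
    (2 ^+ s * ((delta i)%:Z + 4 * z i 0))%:~R :> rat.
  by rewrite intrM intrD intrM rmorphXn.
by rewrite numq_int rmorphM rmorphXn rmorph_nat.
Qed.
End Level.

(** * The search *)

(** The summands pay for the counter, for arithmetic, for writing the query, and for the optimizer.
    Here 56 = 45 + 9 + 2: building the query, evaluating with the sign test, and forming the
    witness. *)
Definition cell_time (c n M : nat) : nat :=
  (n.+1 + 56 * (M * M * op_bound M) + 64 * (M * M * number_bits M)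
   + time_bound c n (64 * (M * M * number_bits M)))%N.

Definition level_time (c n M : nat) : nat :=
  (1 + M * ((5 + 4 * M) ^ 2).+1 + 4 ^ n * cell_time c n M)%N.

Lemma leq_time_bound c n phi phi' : (phi <= phi')%N -> (time_bound c n phi <= time_bound c n phi')%N.
Proof. by case: c => // c le_phi; rewrite leq_mul // leq_exp2r // leq_add2l. Qed.

Section Search.
Variables (F : realType) (c : nat) (opt : optimizer).
Hypothesis optP : convicmin_spec F c opt.
Variables (n M : nat) (I : instance n) (R : int).
Hypotheses (wfI : well_formed F I) (R_ge1 : 1 <= R).
Hypothesis boxR : forall x, regionD F I x -> in_box R x.
Hypotheses (M_gt1 : (1 < M)%N) (le_nM : (n <= M)%N).
Hypotheses (fE : forall i j, fits M (eqs I i j)) (fU : forall i j, fits M (slabs I i j)).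
Hypotheses (fr : forall i, fits M (widths I i 0)) (fQ : forall i j, fits M (formQ I i j)).
Hypotheses (leE : (neqs I <= M)%N) (leU : (nslabs I <= M)%N).
Hypothesis ltR : (`|(R + 1)%R| < 2 ^ M)%N.

Local Opaque cell_query eval_objective witness.

(** Nonnegativity on the level above makes every query admissible, so each answer is exact: a cell
    is passed over only if it has no lattice point or its minimum is nonnegative. *)
Lemma search_cellsP s ds : (s < M)%N -> nonneg_level F I s.+1 ->
  let p := search_cells I (2 ^+ s) (R + 1) ds in
  (if result opt p is Some d
   then regionD F I (real_vec F d) /\ quad (formQ I) (real_vec F d) < 0
   else forall delta, delta \in ds -> nonneg_cell F I s delta) /\
  (run_time opt p <= size ds * cell_time c n M)%N.
Proof.
move=> ltsM nonneg; have [_ symQ _] := wfI.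
have := erefl (cell_time c n M); rewrite {1}/cell_time => eqT.
elim: ds => [|delta ds [IHr IHt]] //=.
set k := cell_data I (2 ^+ s) (R + 1) (digit_vec delta).
have fw : fits M (2 ^+ s) by apply: fits_leq (fits_pow2 s).
have fd i : fits M (digit_vec delta i 0).
  rewrite mxE pmulrn; apply: fits_int; first by lia.
  rewrite absz_nat (leq_trans (ltn_ord _)) // -[4%N]/(2 ^ 2)%N leq_exp2l //.
have [ans costk] := optP (cell_admissible wfI R_ge1 boxR delta nonneg).
have tq := run_time_cell_query opt M_gt1 le_nM fw fd fE fU fr fQ leE leU (R + 1).
have sk := size_cell_data M_gt1 le_nM fw fd fE fU fr fQ leE leU ltR.
have {}costk := leq_trans costk (leq_time_bound c n sk).
have [_ _ _ _ boxk] := cell_admissible wfI R_ge1 boxR delta nonneg.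
rewrite result_bind run_time_bind result_cell_query /= -/k; rewrite -/k in sk costk.
case: (answer opt k) ans => [z [zK zmin]|noz] /=; last first.
  split.
    case: (result _ _) IHr => // IHr delta'; rewrite inE => /orP[/eqP->|]; last exact: IHr.
    by move=> z v zK; case: (noz z); apply/(cellP F I R).
  by rewrite mulSn; lia.
(* The length of the answer is controlled by the radius: its entries are at most [R + 1], which is
   below [2 ^ M]. *)
have fz i : fits M (map_mx intr z i 0).
  rewrite mxE; apply: fits_int; first by lia.
  apply: leq_ltn_trans ltR; have := boxk z zK i.
  by rewrite mxE -intr_norm ler_int /=; lia.
have te := run_time_eval_objective opt M_gt1 le_nM fw fd fQ leE leU fz (R + 1).
have tw := run_time_witness opt M_gt1 le_nM fw fd fQ leE leU fz.
have val := objective_evalE F opt k z.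
have objE y : objective k (real_vec F y) = quad (formQ I) (real_vec F (digit_int delta + 4 *: y)).
  by rewrite cell_data_objective // cell_pointE.
rewrite result_bind run_time_bind /=; rewrite -/k in te.
set v := result opt _ in val te *; case: ifP => v0.
  rewrite result_bind run_time_bind /= real_witness; split.
    split; first exact/(cellP F I R).
    (* The witness carries the factor 2^s, which multiplies q by the positive number 4^s. *)
    rewrite quadZ pmulr_rlt0 ?exprn_gt0 // -objE -val.
    by rewrite -(rmorph0 (@ratr F)) ltr_rat.
  rewrite mulSn; apply: leq_trans (leq_addr _ _); rewrite addn0 (addnA (run_time _ (eval_objective _ _))).
  apply: leq_trans (leq_add (leqnn _) (leq_add tq (leq_add (leq_add sk costk) (leq_add te tw)))) _.
  lia.
split; last first.
  rewrite mulSn (addnA (run_time _ (eval_objective _ _))).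
  apply: leq_trans (leq_add (leqnn _) (leq_add tq (leq_add (leq_add sk costk) (leq_add te IHt)))) _.
  lia.
case: (result _ _) IHr => // IHr delta'; rewrite inE => /orP[/eqP->|]; last exact: IHr.
move=> y y' yK; rewrite -objE; apply: le_trans (zmin y _); last exact/(cellP F I R).
by rewrite -val -(rmorph0 (@ratr F)) ler_rat leNgt v0.
Qed.

(** A level completed without a witness is nonnegative on all its cells, hence entirely, which is
    the hypothesis for the next finer level. Below level 0 nothing remains: 2^0 Z^n contains every
    integer vector. *)
Lemma search_levelsP s : (s <= M)%N -> nonneg_level F I s ->
  let p := search_levels I (R + 1) s in
  correct_answer F I (result opt p) /\ (run_time opt p <= s * level_time c n M)%N.
Proof.
have := erefl (level_time c n M); rewrite {1}/level_time => eqT.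
elim: s => [|s IH] lesM nonneg /=.
  by split=> // d dD; apply: nonneg; rewrite scale1r.
rewrite result_bind run_time_bind result_pow2M result_bind run_time_bind.
have [] := search_cellsP (enum {: digit n}) lesM nonneg.
rewrite -cardE card_digit; set o := result _ _ => oP ot.
have tw : (run_time opt (pow2M s) <= M * ((5 + 4 * M) ^ 2).+1)%N.
  apply: leq_trans (run_time_pow2M _ _) _; rewrite leq_mul ?(ltnW lesM) // ltnS leq_exp2r //.
  by rewrite leq_add2l leq_mul2l ltnW.
case: o oP => [d|] oP /=; first by split=> //; rewrite mulSn; apply: leq_trans (leq_addr _ _); lia.
have [||IHr IHt] := IH; first exact: ltnW.
  by apply: nonneg_cells => delta; apply: oP; rewrite mem_enum.
by split=> //; rewrite mulSn; lia.
Qed.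
End Search.

(** All basic quantities are at most [X], and the proof tracks exponents of [X] only. The three
    summands stand for the initial step, the addition [R + 1], and at most [M] levels. *)
Lemma level_time_leq c n M X : (8 <= X)%N -> (M <= X)%N -> (n < X)%N ->
  (4 ^ n <= X)%N -> (n.+1 ^ n <= X)%N ->
  (X + (5 + 4 * M) ^ 2 + M * level_time c n M <= X ^ (21 + 11 * c))%N.
Proof.
move=> X8 leM ltn le4n lenn.
have X_gt0 : (0 < X)%N by lia.
have leX a b : (a <= b -> X ^ a <= X ^ b)%N by apply: leq_pexp2l.
have mulX a b x y : (x <= X ^ a -> y <= X ^ b -> x * y <= X ^ (a + b))%N.
  by move=> lex ley; rewrite expnD leq_mul.
(* Since [X] is at least 8, a constant factor up to 8 costs one unit of the exponent. *)
have absorb a k x : (k <= 8 -> x <= k * X ^ a -> x <= X ^ a.+1)%N.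
  by move=> k8 lex; rewrite expnS (leq_trans lex) // leq_mul2r (leq_trans k8 X8) orbT.
have {}leM : (M <= X ^ 1)%N by rewrite expn1.
have X64 : (64 <= X ^ 2)%N by rewrite expnS expn1 (leq_mul X8 X8).
have leL : (number_bits M <= X ^ 5)%N.
  by apply: (mulX 2 3) => //; apply: (mulX 2 1) => //; apply: (mulX 1 1).
have le_5 a x : (x <= X ^ a.+1 -> 5 + 4 * x <= X ^ a.+2)%N.
  move=> lex; apply: (absorb _ 8) => //.
  by have := leX 1 a.+1 isT; rewrite expn1; move: (X ^ _)%N lex => Y; lia.
have leW : (op_bound M <= X ^ 12)%N.
  by rewrite /op_bound (expnM _ 6 2) leq_exp2r // le_5.
have leMM : (M * M <= X ^ 2)%N by apply: (mulX 1 1).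
have leQ : (64 * (M * M * number_bits M) <= X ^ 9)%N by apply: (mulX 2 7) => //; apply: (mulX 2 5).
have leWM : (56 * (M * M * op_bound M) <= X ^ 16)%N.
  by apply: (mulX 2 14); [exact: leq_trans X64 | exact: (mulX 2 12)].
(* One plus the query size is at most [X ^ 10], raised to the power [c]; the factor [n.+1 ^ (c * n)]
   adds [X ^ c]. *)
have leT : (time_bound c n (64 * (M * M * number_bits M)) <= X ^ (11 * c))%N.
  have -> : (X ^ (11 * c) = X ^ c * (X ^ 10) ^ c)%N.
    by rewrite -expnM -expnD; congr (_ ^ _)%N; lia.
  rewrite /time_bound [(c * n)%N]mulnC expnM; case: (c) => // c'.
  rewrite leq_mul ?leq_exp2r // (absorb 9 2) //.
  by have := leX 0 9 isT; rewrite expn0; move: (X ^ 9)%N leQ => Y; lia.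
have leC : (cell_time c n M <= X ^ (17 + 11 * c))%N.
  have l1 := leq_trans leT (leX (11 * c) (16 + 11 * c) (leq_addl _ _)).
  have l2 := leq_trans leWM (leX 16 (16 + 11 * c) (leq_addr _ _)).
  have l3 : (64 * (M * M * number_bits M) <= X ^ (16 + 11 * c))%N.
    exact: leq_trans leQ (leX 9 (16 + 11 * c) isT).
  have l4 : (n.+1 <= X ^ (16 + 11 * c))%N.
    by apply: leq_trans ltn _; rewrite -{1}(expn1 X) leX.
  apply: (absorb (16 + 11 * c) 4) => //.
  apply: leq_trans (leq_add (leq_add (leq_add l4 l2) l3) l1) _.
  by move: (X ^ _)%N => Y; lia.
have leP : ((5 + 4 * M) ^ 2 <= X ^ 4)%N by rewrite (expnM _ 2 2) leq_exp2r // le_5.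
have leV : (level_time c n M <= X ^ (19 + 11 * c))%N.
  have l1 : (4 ^ n * cell_time c n M <= X ^ (18 + 11 * c))%N by apply: (mulX 1 _) => //; rewrite expn1.
  have l2 : (((5 + 4 * M) ^ 2).+1 <= X ^ 5)%N.
    apply: (absorb 4 2) => //; rewrite mul2n -addnn -addn1 leq_add //.
    by rewrite expn_gt0 X_gt0.
  have l3 : (M * ((5 + 4 * M) ^ 2).+1 <= X ^ (18 + 11 * c))%N.
    exact: leq_trans (mulX _ _ _ _ leM l2) (leX 6 (18 + 11 * c) isT).
  have l4 : (1 <= X ^ (18 + 11 * c))%N by rewrite expn_gt0 X_gt0.
  apply: (absorb (18 + 11 * c) 3) => //.
  apply: leq_trans (leq_add (leq_add l4 l3) l1) _.
  by move: (X ^ _)%N => Y; lia.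
have l1 := mulX _ _ _ _ leM leV.
have l2 := leq_trans leP (leX 4 (20 + 11 * c) isT).
have l3 := leX 1 (20 + 11 * c) isT; rewrite expn1 in l3.
apply: (absorb (20 + 11 * c) 3) => //.
apply: leq_trans (leq_add (leq_add l3 l2) l1) _.
by move: (X ^ _)%N => Y; lia.
Qed.

(* The first conjunct: the initial step of the algorithm can be carried out in
   polynomial time.  The second one: the algorithm, for every optimizer and
   every realization of its initial step that meet their specifications. *)
Theorem proposition4p3 :
  (exists c0 : nat, forall (F : realType) (opt : optimizer),
     bounding_spec F opt c0 cramer_bounding) /\
  (forall c : nat, exists C : nat,
     forall (F : realType) (opt : optimizer) (bnd : bounding),
       convicmin_spec F c opt -> bounding_spec F opt c bnd ->
       forall (n : nat) (I : instance n), well_formed F I ->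
         [/\ correct_answer F I (result opt (refinement bnd I)),
             (calls opt (refinement bnd I)
                <= (result opt (bnd n I)).2 * 4 ^ n)%N &
             (run_time opt (refinement bnd I)
                <= time_bound C n (size_instance I))%N]).
Proof.
split; first by exists 10%N => F opt; apply: cramer_bounding_correct.
(* [21 + 11 * c] is the exponent of [level_time_leq], applied with [X = B ^ (c + 3)], where [B] is
   (n+1)^n (1 + phi). *)
move=> c; exists ((c + 3) * (21 + 11 * c))%N => F opt bnd optP bndP n I wfI.
rewrite /refinement; have [n0|n_gt0] := posnP n.
  subst n; split => //=; last by rewrite muln_gt0 !expn_gt0.
  (* In dimension 0 the form is an empty sum, so NONNEGATIVE is correct. *)
  by move=> d _; rewrite /quad mxE big_ord0.
have := bndP n I n_gt0 wfI; rewrite result_bind run_time_bind calls_bind.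
case: (result opt (bnd n I)) => R s /= [[R_ge1 boxR] ltR [logR les] calls0 timeb].
have numR : numq (R%:~R + 1) = R + 1 by rewrite -(intrD _ R 1) numq_int.
rewrite calls0 numR.
set phi := size_instance I in logR les timeb *; set phi1 := ((1 + phi) ^ c)%N in logR les timeb.
(* [phi1] covers the level and the length of the radius, [phi] covers the input, and the summand 2
   leaves room for strict inequalities. *)
pose M := (phi1 + phi + 2)%N; pose B := (n.+1 ^ n * (1 + phi))%N.
have phi1_gt0 : (0 < phi1)%N by rewrite expn_gt0.
have M_gt1 : (1 < M)%N by rewrite /M; lia.
have lephi1M : (phi1 <= M)%N by rewrite /M; lia.
have lephiM : (phi <= M)%N by rewrite /M; lia.
have fmx p q (A : 'M[rat]_(p, q)) : (size_mx A <= phi)%N -> forall i j, fits M (A i j).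
  move=> leA i j; apply: fits_leq (fits_size_rat _).
  by apply: leq_trans (leq_size_mx _ _ _) (leq_trans leA _).
have [sE sU sw sQ] : [/\ size_mx (eqs I) <= phi, size_mx (slabs I) <= phi,
    size_mx (widths I) <= phi & size_mx (formQ I) <= phi]%N.
  by rewrite /phi /size_instance; split; lia.
have le_nM : (n <= M)%N by apply: leq_trans (rows_leq_size_mx (formQ I) n_gt0) (leq_trans sQ _).
(* The numbers of equations and slabs are themselves bounded by the encoding length, so the bound
   holds for any number of slabs. *)
have leE : (neqs I <= M)%N by apply: leq_trans (rows_leq_size_mx (eqs I) n_gt0) (leq_trans sE _).
have leU : (nslabs I <= M)%N by apply: leq_trans (rows_leq_size_mx (widths I) isT) (leq_trans sw _).
have ltR1 : (`|(R + 1)%R| < 2 ^ M)%N.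
  apply: leq_ltn_trans (up_logP _ (isT : 1 < 2)%N) _.
  by rewrite ltn_exp2l // (leq_ltn_trans logR) // /M; lia.
have lesM : (s <= M)%N by rewrite /M; lia.
have [res time] := search_levelsP optP wfI R_ge1 boxR M_gt1 le_nM (fmx _ _ _ sE) (fmx _ _ _ sU)
  (fun i => fmx _ _ _ sw i 0) (fmx _ _ _ sQ) leE leU ltR1 lesM (nonneg_top boxR ltR).
split=> //; first exact: calls_search_levels.
have op_add : (op_cost R%:~R 1 <= (5 + 4 * M) ^ 2)%N.
  apply: op_cost_leq; last by apply: (@fits_leq 1) => //; lia.
  by apply: fits_int; [lia | apply: leq_ltn_trans ltR1; lia].
have -> : time_bound ((c + 3) * (21 + 11 * c)) n phi = ((B ^ (c + 3)) ^ (21 + 11 * c))%N.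
  by rewrite /time_bound -expnM expnMn [(_ * n)%N]mulnC expnM.
have phi_gt0 : (0 < phi)%N by [].
have np_gt0 : (0 < n.+1 ^ n)%N by rewrite expn_gt0.
have leB : (1 + phi <= B)%N by rewrite leq_pmull.
have leBn : (n.+1 ^ n <= B)%N by rewrite leq_pmulr.
have B_gt1 : (1 < B)%N by lia.
have leBX k : (k <= 3 -> B ^ k <= B ^ (c + 3))%N.
  by move=> k3; rewrite leq_exp2l // (leq_trans k3) ?leq_addl.
have BX : (B <= B ^ (c + 3))%N by apply: (leBX 1).
(* [phi1] is at most [B ^ c], so [M] is at most [4 * B ^ (c + 1)]; and [4 <= B ^ 2] because [B] is
   at least 2. *)
have leM : (M <= B ^ (c + 3))%N.
  have le1 : (phi1 <= B ^ c)%N by rewrite /phi1; case: (c) => // c'; rewrite leq_exp2r.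
  apply: (@leq_trans (B ^ c * (B * 4))).
    have Y_gt0 : (0 < B ^ c)%N by rewrite expn_gt0 (ltn_trans _ B_gt1).
    have := leq_pmulr (B ^ c)%N (ltnW B_gt1); have := leq_pmull B Y_gt0.
    by move: le1; move: (B ^ c)%N => Y; rewrite /M; lia.
  by rewrite expnD leq_mul // expnS leq_mul // (leq_exp2r 2 B (isT : 0 < 2)%N).
apply: leq_trans (level_time_leq c _ leM _ _ _).
- rewrite -[leqRHS]addnA; apply: leq_add (leq_trans timeb (leq_trans lephi1M leM)) _.
  exact: leq_add op_add (leq_trans time (leq_mul lesM (leqnn _))).
- by apply: leq_trans (leBX 3 isT); rewrite (leq_exp2r 2 B (isT : 0 < 3)%N).
- apply: leq_trans (leq_trans leBn BX).
  by rewrite -{1}(expn1 n.+1) leq_exp2l.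
(* Here 4^n = (2^n)^2 is at most ((n+1)^n)^2, since n is positive. *)
- apply: leq_trans (leBX 2 isT); rewrite -[4%N]/(2 ^ 2)%N -expnM mulnC expnM leq_exp2r //.
  by apply: leq_trans leBn; rewrite leq_exp2r.
exact: leq_trans leBn BX.
Qed.
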